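(* Let $\mathfrak{g}(t)$ be either $\mathfrak{g}_{147E_1}(t)$ with $t>1$, or $\mathfrak{g}_{147E}(t)$ with $t>1$, $t\neq2$. Then $\dim H^2_{3\text{-}nil}(\mathfrak{g}(t),\mathfrak{g}(t))=1$, and the nonzero cohomology class is that of the tangent vector (derivative in $t$) of the curve $\mathfrak{g}(t)$; moreover $\dim H^2_{3\text{-}nil}(\mathfrak{g}_{147E}(2),\mathfrak{g}_{147E}(2))=3$. Consequently $$\{\mathfrak{g}_{147E}(t):1<t<2\},\qquad \{\mathfrak{g}_{147E}(t):2<t\},\qquad \{\mathfrak{g}_{147E_1}(t):1<t\}$$ are rigid curves in $\mathcal{N}_{7,3}$.
   Context: In structure tables, $xy$ denotes the bracket $[x,y]$ of elements of the basis $a,b,c,d,e,f,g$ of a $7$-dimensional real vector space; brackets not listed and not determined by skew-symmetry are zero. $\mathfrak{g}_{147E}(t)$: $ab=d$, $ac=-f$, $ae=-g$, $bc=e$, $bf=tg$, $cd=(1-t)g$. $\mathfrak{g}_{147E_1}(t)$: $ab=d$, $ac=-f$, $af=-tg$, $bc=e$, $be=tg$, $bf=2g$, $cd=-2g$. For an $n$-dimensional real vector space $\mathfrak{g}$ and $\sigma\in\Lambda^2\mathfrak{g}^*\otimes\mathfrak{g}$ put $J(\sigma)(x,y,z)=\sum_{cyclic}\sigma(\sigma(x,y),z)$, $N_1(\sigma)(x_1,x_2)=\sigma(x_1,x_2)$ and $N_k(\sigma)(x_1,\dots,x_{k+1})=\sigma(N_{k-1}(\sigma)(x_1,\dots,x_k),x_{k+1})$.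 $\mathcal{N}_{n,k}=\{\sigma: J(\sigma)=0,\ N_k(\sigma)=0\}$ is the variety of (at most) $k$-step nilpotent Lie algebra structures on $\mathfrak{g}$. For $\mu\in\mathcal{N}_{n,k}$, $H^2_{k\text{-}nil}(\mathfrak{g},\mathfrak{g})=\big(\mathrm{Ker}(d^2_\mu)\cap\mathrm{Ker}(dN_k|_\mu)\big)/\mathrm{Im}(d^1_\mu)$, where $d^1_\mu,d^2_\mu$ are the Chevalley–Eilenberg differentials with adjoint coefficients (on $\mathfrak{g}^*\otimes\mathfrak{g}$ and $\Lambda^2\mathfrak{g}^*\otimes\mathfrak{g}$) and $dN_k|_\mu$ is the differential of the map $N_k$ at $\mu$. A curve $\{\mu(t):t\in T\}$ ($T\subset\mathbb{R}$ open) contained in a variety $\mathcal{V}$ of Lie algebra structures is called a rigid curve in $\mathcal{V}$ if for every $t_0\in T$ there is a neighborhood $U\subset\mathcal{V}$ of $\mu(t_0)$ (metric topology) such that every $\nu\in U$ is isomorphic to $\mu(t)$ for some $t\in T$. *)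

(* Defs.v *)
From HB Require Import structures.
From mathcomp Require Import all_boot all_order all_algebra.
From mathcomp Require Import all_classical all_reals all_analysis.

Set Implicit Arguments.
Unset Strict Implicit.
Unset Printing Implicit Defensive.

Import Order.TTheory GRing.Theory Num.Theory.
Import numFieldNormedType.Exports.

Local Open Scope classical_set_scope.
Local Open Scope ring_scope.

(* The underlying vector space is g = 'rV[R]_n.  A bilinear map g x g -> g is
   stored as the linear map g (x) g -> g it induces, i.e. as a matrix in
   'M[R]_(n * n, n): row [mxvec_index i j] holds the value on the basis pair
   (e_i, e_j).  The metric topology, the differential calculus and \dim are
   those of this matrix space. *)
Notation bilin R n := 'M[R]_(n * n, n).

Section Structures.
Variables (R : realType) (n : nat).
Implicit Types (s mu nu tau : bilin R n) (x y z : 'rV[R]_n) (k : nat).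

Definition br s x y : 'rV[R]_n := mxvec (x^T *m y) *m s.

(* s belongs to Lambda^2 g^* (x) g. *)
Definition alternating s : Prop := forall x, br s x x = 0.

Definition jacobiator s x y z : 'rV[R]_n :=
  br s (br s x y) z + br s (br s y z) x + br s (br s z x) y.

(* [Nk k s x] is N_k(s)(x 0, ..., x k); later values of x are irrelevant.
   Starting from N_0(x_1) = x_1, one gets N_1(s)(x_1, x_2) = s(x_1, x_2). *)
Fixpoint Nk k s (x : nat -> 'rV[R]_n) : 'rV[R]_n :=
  if k is k'.+1 then br s (Nk k' s x) (x k) else x 0%N.

Definition nilvar k : set (bilin R n) :=
  [set s | [/\ alternating s, (forall x y z, jacobiator s x y z = 0)
             & (forall x : nat -> 'rV[R]_n, Nk k s x = 0)]].

(* Chevalley-Eilenberg differentials with adjoint coefficients; f : 'M_n stands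
   for the endomorphism x |-> x *m f. *)
Definition d1 mu (f : 'M[R]_n) x y : 'rV[R]_n :=
  br mu x (y *m f) - br mu y (x *m f) - br mu x y *m f.

Definition d2 mu tau x y z : 'rV[R]_n :=
  br mu x (br tau y z) - br mu y (br tau x z) + br mu z (br tau x y)
  - br tau (br mu x y) z + br tau (br mu x z) y - br tau (br mu y z) x.

(* Ker(d^2_mu) and Ker(dN_k|_mu), in Lambda^2 g^* (x) g.  N_k takes values in
   the multilinear maps, so its differential is computed argumentwise. *)
Definition ker_d2 mu : set (bilin R n) :=
  [set tau | alternating tau /\ forall x y z, d2 mu tau x y z = 0].

Definition ker_dN k mu : set (bilin R n) :=
  [set tau | alternating tau /\
     forall x : nat -> 'rV[R]_n, 'd (fun s : bilin R n => Nk k s x) mu tau = 0].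

Definition Z2nil k mu : set (bilin R n) := ker_d2 mu `&` ker_dN k mu.

Definition B2 mu : set (bilin R n) :=
  [set tau | exists f : 'M[R]_n, forall x y, br tau x y = d1 mu f x y].

(* dim (U / W) = d for linear subspaces W <= U, given as sets. *)
Definition dim_quot (V : vectType R) (U W : set V) (d : nat) : Prop :=
  exists Us Ws : {vspace V},
    [/\ U = [set` Us], W = [set` Ws], (Ws <= Us)%VS
      & \dim Us = (\dim Ws + d)%N].

Definition dim_H2nil k mu (d : nat) : Prop := dim_quot (Z2nil k mu) (B2 mu) d.

Definition isomorphic mu nu : Prop :=
  exists2 phi : 'M[R]_n, phi \in unitmx &
    forall x y, br mu x y *m phi = br nu (x *m phi) (y *m phi).

Definition rigid_curve (V : set (bilin R n)) (T : set R) (mu : R -> bilin R n) :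
    Prop :=
  [/\ open T, {in T, continuous mu}, (forall t, T t -> V (mu t))
    & forall t0, T t0 ->
        \forall nu \near within V (nbhs (mu t0)),
          exists2 t, T t & isomorphic nu (mu t)].

(* e_i^* /\ e_j^* (x) v : the bracket with e_i e_j = v = - e_j e_i, all other
   products of basis vectors being zero. *)
Definition wedge (i j : 'I_n) (v : 'rV[R]_n) : bilin R n :=
  (mxvec (delta_mx i j - delta_mx j i))^T *m v.

Lemma br_wedge i j v x y :
  br (wedge i j v) x y = (x 0 i * y 0 j - x 0 j * y 0 i) *: v.
Proof.
have mxvec_dot (A B : 'M[R]_n) :
    mxvec A *m (mxvec B)^T = (\sum_i \sum_j A i j * B i j)%:M.
  apply/matrixP=> p q; rewrite !ord1 !mxE eqxx mulr1n.
  rewrite (reindex _ (curry_mxvec_bij n n)) /= pair_bigA.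
  by apply: eq_bigr => -[a b] _ /=; rewrite mxE !mxvecE.
have pick (p q : 'I_n) :
    \sum_a \sum_b (x^T *m y) a b * (delta_mx p q : 'M[R]_n) a b = x 0 p * y 0 q.
  rewrite (bigD1 p) //= (bigD1 q) //= !big1 ?addr0.
  - by rewrite !mxE !eqxx mulr1 big_ord1 !mxE.
  - by move=> a nap; rewrite big1 // => b _; rewrite [delta_mx _ _ _ _]mxE
      (negPf nap) mulr0.
  - by move=> b nbq; rewrite [delta_mx _ _ _ _]mxE (negPf nbq) andbF mulr0.
rewrite /br /wedge mulmxA mxvec_dot mul_scalar_mx; congr (_ *: _).
rewrite -!pick -sumrB; apply: eq_bigr => a _; rewrite -sumrB.
by apply: eq_bigr => b _; rewrite -mulrBr !mxE.
Qed.

End Structures.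

Arguments nilvar : clear implicits.

Section Families.
Variable R : realType.

Local Notation a := (@Ordinal 7 0 isT).
Local Notation b := (@Ordinal 7 1 isT).
Local Notation c := (@Ordinal 7 2 isT).
Local Notation d := (@Ordinal 7 3 isT).
Local Notation e := (@Ordinal 7 4 isT).
Local Notation f := (@Ordinal 7 5 isT).
Local Notation g := (@Ordinal 7 6 isT).
Local Notation vec := (delta_mx 0).

Definition g147E (t : R) : bilin R 7 :=
  wedge a b (vec d) + wedge a c (- vec f) + wedge a e (- vec g)
  + wedge b c (vec e) + wedge b f (t *: vec g) + wedge c d ((1 - t) *: vec g).

Definition g147E1 (t : R) : bilin R 7 :=
  wedge a b (vec d) + wedge a c (- vec f) + wedge a f (- t *: vec g)
  + wedge b c (vec e) + wedge b e (t *: vec g) + wedge b f (2 *: vec g)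
  + wedge c d (- 2 *: vec g).

End Families.

(* Main.v *)
From Pilot Require Import Defs.
From HB Require Import structures.
From mathcomp Require Import all_boot all_order all_algebra.
From mathcomp Require Import all_classical all_reals all_analysis.
From mathcomp Require Import ring lra.
Import Pilot.Defs.
Import Order.TTheory GRing.Theory Num.Theory.
Import numFieldNormedType.Exports.
Local Open Scope classical_set_scope.
Local Open Scope ring_scope.

Set Implicit Arguments.
Unset Strict Implicit.
Unset Printing Implicit Defensive.

(** Both families belong to one picture.  Let V = <a, b, c>.  The brackets
[b,c], [c,a], [a,b] span a copy of Lambda^2 V, that is, of the dual of V, and
brackets of three elements land in the line of g.  So the structure is a
bilinear form on V x V^*, a 3 x 3 matrix N with [X_i, W_j] = N_ij g, where
(X_0, X_1, X_2) = (a, b, c) and (W_0, W_1, W_2) = (bc, ca, ab).  The Jacobi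
identity says exactly that N has trace zero.  A change of generators conjugates
N and rescales it, so similar matrices, up to a nonzero scalar, give isomorphic
structures ([isomorphic_similar]).  The matrix of 147E(t) is diag(-1, t, 1-t);
that of 147E_1(t) has eigenvalue -2 and, for t > 1, a pair of non-real
eigenvalues with sum 2 and product t^2.

Cohomology.  The change of basis suggested by this normal form also works to
first order: modulo coboundaries, a cocycle of a structure with invertible N
only changes N ([Z2nil_normal_form]), and a change M of N is a coboundary exactly
when M = A N - N A + r N ([central_B2], [B2_central]).  Hence the cohomology is
sl_3 / ([gl_3, N] + R N).  It is a line when N has three distinct complex
eigenvalues, spanned by the derivative of the curve; for N = diag(-1, 2, -1) the
centraliser is larger and the dimension is 3.

Rigidity.  If nu is close to a structure with invertible matrix, then a, b, c,
their brackets under nu and one triple bracket still form a basis, and nilpotency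
forces nu to be in normal form in that basis up to the scale of the last vector,
with a matrix depending polynomially on nu
([nilvar_normal_form], [near_normal_form]).  What remains is linear algebra on a
traceless matrix M with det M <> 0 and characteristic polynomial
X^3 + p X - det M.  If 4 p^3 + 27 det^2 < 0 there are three distinct real
eigenvalues, and scaling one of them to -1 gives diag(-1, t, 1-t)
([isomorphic_147E]); if it is positive there is one real eigenvalue, which is
scaled to -2 ([isomorphic_147E1]).  These conditions on M are open.  In the real
case the eigenvalue scaled to -1 can be chosen so that 1 < t < 2, and also so
that t > 2, which is why each of the two intervals is rigid by itself. *)

(** * The bracket as a multilinear expression *)
Section Bilinear.
Variables (R : realType) (n : nat).
Implicit Types (s mu tau : bilin R n) (x y z : 'rV[R]_n) (f : 'M[R]_n).

Lemma brDl s x x' y : br s (x + x') y = br s x y + br s x' y.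
Proof. by rewrite /br linearD /= mulmxDl linearD /= mulmxDl. Qed.
Lemma brDr s x y y' : br s x (y + y') = br s x y + br s x y'.
Proof. by rewrite /br mulmxDr linearD /= mulmxDl. Qed.
Lemma brZl s a x y : br s (a *: x) y = a *: br s x y.
Proof. by rewrite /br linearZ /= -scalemxAl linearZ /= -scalemxAl. Qed.
Lemma brZr s a x y : br s x (a *: y) = a *: br s x y.
Proof. by rewrite /br -scalemxAr linearZ /= -scalemxAl. Qed.
Lemma brNl s x y : br s (- x) y = - br s x y.
Proof. by rewrite -scaleN1r brZl scaleN1r. Qed.
Lemma brNr s x y : br s x (- y) = - br s x y.
Proof. by rewrite -scaleN1r brZr scaleN1r. Qed.
Lemma br0l s y : br s 0 y = 0.
Proof. by have := brZl s 0 0 y; rewrite !scale0r. Qed.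
Lemma br0r s x : br s x 0 = 0.
Proof. by have := brZr s 0 x 0; rewrite !scale0r. Qed.
Lemma brBl s x x' y : br s (x - x') y = br s x y - br s x' y.
Proof. by rewrite brDl brNl. Qed.
Lemma br_suml s (I : finType) (F : I -> 'rV_n) y :
  br s (\sum_i F i) y = \sum_i br s (F i) y.
Proof. exact: (big_morph _ (fun u v => brDl s u v y) (br0l s y)). Qed.
Lemma br_sumr s (I : finType) (F : I -> 'rV_n) x :
  br s x (\sum_i F i) = \sum_i br s x (F i).
Proof. exact: (big_morph _ (brDr s x) (br0r s x)). Qed.
Lemma brDm s s' x y : br (s + s') x y = br s x y + br s' x y.
Proof. by rewrite /br mulmxDr. Qed.
Lemma brZm a s x y : br (a *: s) x y = a *: br s x y.
Proof. by rewrite /br -scalemxAr. Qed.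
Lemma brNm s x y : br (- s) x y = - br s x y.
Proof. by rewrite /br mulmxN. Qed.
Lemma br_summ (I : finType) (F : I -> bilin R n) x y :
  br (\sum_i F i) x y = \sum_i br (F i) x y.
Proof.
by apply: (big_morph _ (fun u v => brDm u v x y)); rewrite /br mulmx0.
Qed.

Definition brE := (brDl, brDr, brNl, brNr, brZl, brZr, brDm, brNm, brZm).

Lemma br_alt s x y : alternating s -> br s y x = - br s x y.
Proof.
move=> As; apply/eqP; rewrite -addr_eq0; apply/eqP.
by have := As (x + y); rewrite !brE !As add0r addr0 addrC.
Qed.

Lemma br_delta s i j : br s (delta_mx 0 i) (delta_mx 0 j) = row (mxvec_index i j) s.
Proof. by rewrite /br trmx_delta mul_delta_mx mxvec_delta rowE. Qed.

Lemma br_expand s x y :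
  br s x y = \sum_i \sum_j (x 0 i * y 0 j) *: row (mxvec_index i j) s.
Proof.
rewrite [x in LHS]row_sum_delta [y in LHS]row_sum_delta br_suml; apply: eq_bigr => i _.
rewrite br_sumr; apply: eq_bigr => j _.
by rewrite brZl brZr br_delta scalerA.
Qed.

Lemma br_ext s s' :
  (forall i j, br s (delta_mx 0 i) (delta_mx 0 j) =
               br s' (delta_mx 0 i) (delta_mx 0 j)) -> s = s'.
Proof.
move=> H; apply/row_matrixP => k; case/mxvec_indexP: k => i j.
by rewrite -!br_delta.
Qed.

(** [d1 mu f] repackaged as an element of the space of brackets, so that the
coboundaries become the image of a linear map. *)
Definition coboundary mu f : bilin R n :=
  \matrix_(k < n * n) \sum_i \sum_j (if k == mxvec_index i j
     then d1 mu f (delta_mx 0 i) (delta_mx 0 j) else 0).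

Lemma d1Dl mu f x x' y : d1 mu f (x + x') y = d1 mu f x y + d1 mu f x' y.
Proof.
rewrite /d1 !(brE, mulmxDl); apply/rowP => k; rewrite !mxE; ring.
Qed.
Lemma d1Dr mu f x y y' : d1 mu f x (y + y') = d1 mu f x y + d1 mu f x y'.
Proof.
rewrite /d1 !(brE, mulmxDl); apply/rowP => k; rewrite !mxE; ring.
Qed.
Lemma d1Zl mu f a x y : d1 mu f (a *: x) y = a *: d1 mu f x y.
Proof. by rewrite /d1 !(brE, =^~ scalemxAl) !scalerBr. Qed.
Lemma d1Zr mu f a x y : d1 mu f x (a *: y) = a *: d1 mu f x y.
Proof. by rewrite /d1 !(brE, =^~ scalemxAl) !scalerBr. Qed.

Lemma coboundaryE mu f x y : br (coboundary mu f) x y = d1 mu f x y.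
Proof.
have d10l u : d1 mu f 0 u = 0 by have := d1Zl mu f 0 0 u; rewrite !scale0r.
have d10r u : d1 mu f u 0 = 0 by have := d1Zr mu f 0 u 0; rewrite !scale0r.
rewrite br_expand [x in RHS]row_sum_delta [y in RHS]row_sum_delta.
rewrite (big_morph (fun x => d1 mu f x _) (fun u v => d1Dl mu f u v _) (d10l _)).
apply: eq_bigr => i _; rewrite (big_morph _ (d1Dr mu f _) (d10r _)).
apply: eq_bigr => j _; rewrite d1Zl d1Zr scalerA; congr (_ *: _).
rewrite rowK (bigD1 i) //= (bigD1 j) //= eqxx !big1 ?addr0 //.
  move=> i' nii'; rewrite big1 // => j' _; case: eqP => //.
  by move=> /cast_ord_inj/enum_rank_inj[E _]; rewrite E eqxx in nii'.
move=> j' njj'; case: eqP => //.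
by move=> /cast_ord_inj/enum_rank_inj[E]; rewrite E eqxx in njj'.
Qed.

Lemma coboundary_linear mu : linear (coboundary mu).
Proof.
move=> a f g; apply: br_ext => i j; rewrite !brE !coboundaryE /d1 !mulmxDr.
rewrite -!scalemxAr !brE; apply/rowP => k; rewrite !mxE; ring.
Qed.

End Bilinear.

(** * Cocycles and coboundaries of nilpotent structures *)
Section Cocycles.
Variables (R : realType) (n : nat).
Implicit Types (s mu tau : bilin R n) (x y z : 'rV[R]_n) (f : 'M[R]_n).

(** The differential of [Nk k] at [mu], by the product rule applied to the
recursion defining [Nk]; [diff_Nk] justifies the name. *)
Fixpoint dNk k mu tau (x : nat -> 'rV[R]_n) : 'rV[R]_n :=
  if k is k'.+1 then br tau (Nk k' mu x) (x k) + br mu (dNk k' mu tau x) (x k)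
  else 0.

Lemma is_diff_bigsum (V W : normedModType R) (I : finType) (F dF : I -> V -> W)
    (v : V) :
  (forall i, is_diff v (F i) (dF i)) ->
  is_diff v (fun u => \sum_i F i u) (fun u => \sum_i dF i u).
Proof.
move=> H; elim: (index_enum I) => [|i r IH].
  by under eq_fun do rewrite big_nil; under [X in is_diff _ _ X]eq_fun do rewrite big_nil;
    exact: is_diff_cst.
under eq_fun do rewrite big_cons; under [X in is_diff _ _ X]eq_fun do rewrite big_cons.
exact: is_diffD (H i) IH.
Qed.

Lemma br_coord s x y k :
  br s x y 0 k = \sum_i \sum_j (x 0 i * y 0 j) * s (mxvec_index i j) k.
Proof.
rewrite br_expand summxE; apply: eq_bigr => i _; rewrite summxE.
by apply: eq_bigr => j _; rewrite !mxE.
Qed.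

Lemma is_diff_entry m p i j (M : 'M[R]_(m, p)) :
  is_diff M (fun N : 'M[R]_(m, p) => N i j : R) (fun N => N i j).
Proof.
have @f : {linear 'M[R]_(m, p) -> R}.
  by exists (fun N : 'M[R]_(_, _) => N i j); do 2![eexists]; do ?[constructor];
     rewrite ?mxE// => ? *; rewrite ?mxE//; move=> ?; rewrite !mxE.
have fc : continuous f by exact: coord_continuous.
by apply: DiffDef; [exact: (linear_differentiable (f := f))|exact: (diff_lin (f := f))].
Qed.

(** Each coordinate of an iterated bracket is a polynomial in the entries of the
structure, built by sums and products, so the product rule for real-valued functions
applies. *)
Lemma is_diff_Nk_coord k mu (x : nat -> 'rV[R]_n) j :
  is_diff mu (fun s => Nk k s x 0 j) (fun tau => dNk k mu tau x 0 j).
Proof.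
elim: k j => [|k IH] j /=.
  have -> : (fun tau : bilin R n => (0 : 'rV[R]_n) 0 j) = 0.
    by apply/funext => tau; rewrite mxE.
  exact: is_diff_cst.
have -> : (fun s => br s (Nk k s x) (x k.+1) 0 j) =
    (fun s => \sum_i \sum_l (Nk k s x 0 i * (x k.+1 0 l * s (mxvec_index i l) j))).
  apply/funext => s; rewrite br_coord; apply: eq_bigr => i _.
  by apply: eq_bigr => l _; rewrite mulrA.
have -> : (fun tau => (br tau (Nk k mu x) (x k.+1) +
     br mu (dNk k mu tau x) (x k.+1)) 0 j) =
    (fun tau => \sum_i \sum_l (Nk k mu x 0 i * (x k.+1 0 l * tau (mxvec_index i l) j)
      + (x k.+1 0 l * mu (mxvec_index i l) j) * dNk k mu tau x 0 i)).
  apply/funext => tau; rewrite mxE !br_coord -big_split; apply: eq_bigr => i _ /=.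
  by rewrite -big_split; apply: eq_bigr => l _ /=; ring.
apply: is_diff_bigsum => i; apply: is_diff_bigsum => l.
exact: (is_diffM (IH i) (is_diffZ (x k.+1 0 l) (is_diff_entry (mxvec_index i l) j mu))).
Qed.

Lemma diff_Nk k mu tau (x : nat -> 'rV[R]_n) :
  'd (fun s : bilin R n => Nk k s x) mu tau = dNk k mu tau x.
Proof.
have E (h : bilin R n -> 'rV[R]_n) :
    h = fun s => \sum_j h s 0 j *: delta_mx 0 j.
  by apply/funext => s; exact: row_sum_delta.
suff H : is_diff mu (fun s => Nk k s x) (fun tau => dNk k mu tau x).
  by rewrite diff_val.
rewrite [X in is_diff _ X _]E [X in is_diff _ _ X]E.
apply: is_diff_bigsum => j; have H := is_diff_Nk_coord k mu x j.
by apply: DiffDef; [exact: differentiableZl|rewrite diffZl // diff_val].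
Qed.

(** On alternating arguments the Chevalley-Eilenberg differential is, up to sign,
the linearisation of the Jacobiator. *)
Lemma d2_linJ mu tau x y z : alternating mu -> alternating tau ->
  d2 mu tau x y z = - (br tau (br mu x y) z + br tau (br mu y z) x + br tau (br mu z x) y
   + br mu (br tau x y) z + br mu (br tau y z) x + br mu (br tau z x) y).
Proof.
move=> Am At; rewrite /d2.
have AmE u v := br_alt v u Am; have AtE u v := br_alt v u At.
rewrite (AmE x (br tau y z)) (AmE y (br tau x z)) (AmE z (br tau x y)).
rewrite (AtE x z) (AmE x z) !brNl.
by apply/rowP => k; rewrite !mxE; ring.
Qed.

Lemma d1_alternating mu f : alternating mu -> alternating (coboundary mu f).
Proof. by move=> Am x; rewrite coboundaryE /d1 Am mul0mx subr0 subrr. Qed.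

Lemma d1_derivation mu f x y : alternating mu ->
  d1 mu f x y = br mu (x *m f) y + br mu x (y *m f) - br mu x y *m f.
Proof.
by move=> Am; rewrite /d1 (br_alt (x *m f) y Am) opprK [X in X - _ = _]addrC.
Qed.

(** Coboundaries are tangent to the orbit of [mu].  Concretely, [d1 mu f] measures
the failure of [f] to be a derivation, and the linearised equations telescope to
the equations of the variety with [f] inserted in one argument at a time. *)
Lemma d1_Z2nil k mu f : nilvar R n k mu -> Z2nil k mu (coboundary mu f).
Proof.
case=> Am Jm Nm; have At := d1_alternating f Am; split; split=> //.
  move=> x y z; rewrite d2_linJ // !coboundaryE !d1_derivation // !(brE, mulmxDl, mulNmx).
  have J1 := Jm (x *m f) y z; have J2 := Jm x (y *m f) z; have J3 := Jm x y (z *m f).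
  have := congr1 (mulmx^~ f) (Jm x y z); move: J1 J2 J3.
  rewrite /jacobiator !mulmxDl mul0mx.
  move=> /rowP J1 /rowP J2 /rowP J3 /rowP J4; apply/rowP => i.
  move: (J1 i) (J2 i) (J3 i) (J4 i); rewrite !mxE; lra.
move=> x; rewrite diff_Nk.
pose F m (s : bilin R n) := Nk m s.
pose xf i : nat -> 'rV[R]_n := fun j => if j == i then x j *m f else x j.
suff H m : dNk m mu (coboundary mu f) x =
    \sum_(i < m.+1) Nk m mu (xf i) - Nk m mu x *m f.
  by rewrite H Nm mul0mx subr0 big1.
(* N_p depends only on the arguments up to index p. *)
have out p i : (p < i)%N -> Nk p mu (xf i) = Nk p mu x.
  elim: p => [|p IHp] lt_pi /=; first by rewrite /xf ltn_eqF.
  by rewrite IHp ?(ltnW lt_pi) // /xf ltn_eqF.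
elim: m => [|m IHm] /=; first by rewrite big_ord1 /xf eqxx subrr.
rewrite IHm coboundaryE d1_derivation // [in RHS]big_ord_recr /= out // [xf m.+1 m.+1]/xf eqxx.
rewrite [in RHS](eq_bigr (fun i : 'I_m.+1 => br mu (Nk m mu (xf i)) (x m.+1))); last first.
  by move=> i _; rewrite [xf _ m.+1]/xf gtn_eqF.
rewrite -br_suml brBl; apply/rowP => j; rewrite !mxE; ring.
Qed.

Lemma B2_coboundary mu tau : B2 mu tau <-> exists f, tau = coboundary mu f.
Proof.
split=> [[f H]|[f ->]]; exists f; last by move=> x y; rewrite coboundaryE.
by apply: br_ext => i j; rewrite coboundaryE.
Qed.

Lemma dNkP k mu a tau tau' (x : nat -> 'rV[R]_n) :
  dNk k mu (a *: tau + tau') x = a *: dNk k mu tau x + dNk k mu tau' x.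
Proof.
elim: k => [|k IH] /=; first by rewrite scaler0 addr0.
by rewrite IH !brE; apply/rowP => j; rewrite !mxE; ring.
Qed.

Lemma Z2nilP k mu a tau tau' :
  Z2nil k mu tau -> Z2nil k mu tau' -> Z2nil k mu (a *: tau + tau').
Proof.
case=> [[At dt] [_ Nt]] [[At' dt'] [_ Nt']].
have A : alternating (a *: tau + tau') by move=> x; rewrite !brE At At' scaler0 addr0.
split; split=> //; [move=> x y z|move=> x].
  have -> : d2 mu (a *: tau + tau') x y z = a *: d2 mu tau x y z + d2 mu tau' x y z.
    by rewrite /d2 !brE; apply/rowP => j; rewrite !mxE; ring.
  by rewrite dt dt' scaler0 addr0.
have := Nt x; have := Nt' x; rewrite !diff_Nk dNkP => -> ->.
by rewrite scaler0 addr0.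
Qed.

Lemma Z2nil0 k mu : Z2nil k mu 0.
Proof.
have b0 x y : br (0 : bilin R n) x y = 0 by rewrite /br mulmx0.
split; split=> //; [move=> x y z|move=> x]; first by rewrite /d2 !b0 !br0r !(subr0, addr0).
rewrite diff_Nk; elim: k => //= k ->.
by rewrite b0 br0l addr0.
Qed.

Lemma Z2nilD k mu tau tau' :
  Z2nil k mu tau -> Z2nil k mu tau' -> Z2nil k mu (tau + tau').
Proof. by move=> Zt Zt'; rewrite -[tau]scale1r; apply: Z2nilP. Qed.

Lemma Z2nilZ k mu a tau : Z2nil k mu tau -> Z2nil k mu (a *: tau).
Proof. by move=> Zt; rewrite -[_ *: _]addr0; apply: Z2nilP => //; apply: Z2nil0. Qed.

(** The dimension is read off from a family [u] that spans the cocycles modulo the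
coboundaries and is independent modulo them. *)
Lemma dim_H2nil_complement k mu d (u : d.-tuple (bilin R n)) :
  nilvar R n k mu ->
  (forall i : 'I_d, Z2nil k mu (tnth u i)) ->
  (forall tau, Z2nil k mu tau ->
     exists f (c : 'I_d -> R), tau = coboundary mu f + \sum_i c i *: tnth u i) ->
  (forall (c : 'I_d -> R) f, \sum_i c i *: tnth u i = coboundary mu f -> forall i, c i = 0) ->
  dim_H2nil k mu d.
Proof.
move=> Vm uZ gen indep.
pose lM := GRing.isLinear.Build _ _ _ _ _ (coboundary_linear mu).
pose L : {linear 'M[R]_n -> bilin R n} := HB.pack (coboundary mu) lM.
have imL tau : (tau \in limg (linfun L)) <-> exists f, tau = coboundary mu f.
  split=> [/memv_imgP[f _ ->]|[f ->]]; first by exists f; rewrite lfunE.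
  by apply/memv_imgP; exists f; rewrite ?memvf ?lfunE.
have freeu : free u.
  apply/freeP => c c0; apply: (indep c 0).
  under eq_bigr do rewrite (tnth_nth 0).
  rewrite c0; apply: esym; apply: br_ext => i j.
  by rewrite coboundaryE /d1 !mulmx0 !br0r !subr0 /br mulmx0.
exists (limg (linfun L) + <<u>>)%VS, (limg (linfun L)); split.
- apply/seteqP; split=> tau /=.
    case/gen => f [c ->]; apply: memv_add; first by apply/imL; exists f.
    by apply: memv_suml => i _; apply/memvZ/memv_span/mem_tnth.
  case/memv_addP => t1 /imL[f ->] [t2 /coord_span -> ->].
  apply: Z2nilD; first exact: d1_Z2nil.
  apply: (big_ind (Z2nil k mu)) => [||i _]; [exact: Z2nil0|exact: Z2nilD|].
  by rewrite -tnth_nth; apply: Z2nilZ.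
- by apply/seteqP; split=> tau /=; [move/B2_coboundary/imL|move/imL/B2_coboundary].
- exact: addvSl.
- rewrite dimv_disjoint_sum ?(eqP freeu) ?size_tuple //.
  apply/eqP; rewrite -subv0; apply/subvP => t /memv_capP[/imL[f tf] tu].
  rewrite memv0 (coord_span tu) big1 // => i _;
  rewrite (indep (fun i => coord u i t) f) ?scale0r //.
  by rewrite -tf [RHS](coord_span tu); apply: eq_bigr => j _; rewrite (tnth_nth 0).
Qed.
End Cocycles.

(** * The structures attached to 3 x 3 matrices *)
Local Notation i0 := (@Ordinal 3 0 isT).
Local Notation i1 := (@Ordinal 3 1 isT).
Local Notation i2 := (@Ordinal 3 2 isT).

Definition nxt (i : 'I_3) : 'I_3 :=
  match val i with 0%N => i1 | 1%N => i2 | _ => i0 end.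

(** The positions of a, b, c in the basis a, ..., g. *)
Definition gen (i : 'I_3) : 'I_7 :=
  match val i with
  | 0%N => @Ordinal 7 0 isT | 1%N => @Ordinal 7 1 isT | _ => @Ordinal 7 2 isT end.

(** The positions of e = bc, f = ca, d = ab.  This order makes W_j the bracket of
the two generators following X_j cyclically, so it is dual to a, b, c. *)
Definition com (j : 'I_3) : 'I_7 :=
  match val j with
  | 0%N => @Ordinal 7 4 isT | 1%N => @Ordinal 7 5 isT | _ => @Ordinal 7 3 isT end.

Definition ctr : 'I_7 := @Ordinal 7 6 isT.

Lemma ord3_ind (P : 'I_3 -> Prop) : P i0 -> P i1 -> P i2 -> forall i, P i.
Proof.
by move=> p0 p1 p2 [[|[|[|//]]] lt]; rewrite (bool_irrelevance lt isT).
Qed.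

Lemma sum3 (V : nmodType) (F : 'I_3 -> V) : \sum_i F i = F i0 + F i1 + F i2.
Proof.
rewrite !big_ord_recl big_ord0 addr0 addrA.
by congr (F _ + F _ + F _); apply: val_inj.
Qed.

Lemma ord3_pair (P : 'I_3 -> 'I_3 -> Prop) :
  (forall i, P i i) -> (forall j, P (nxt j) (nxt (nxt j))) ->
  (forall j, P (nxt (nxt j)) (nxt j)) -> forall i j, P i j.
Proof.
move=> d p q; elim/ord3_ind; elim/ord3_ind; (exact: d || exact: (p i0) ||
  exact: (p i1) || exact: (p i2) || exact: (q i0) || exact: (q i1) || exact: (q i2)).
Qed.

Lemma ord7_ind (P : 'I_7 -> Prop) :
  (forall i, P (gen i)) -> (forall j, P (com j)) -> P ctr -> forall k, P k.
Proof.
move=> g c z [[|[|[|[|[|[|[|//]]]]]]] lt]; rewrite (bool_irrelevance lt isT).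
- exact: g i0. - exact: g i1. - exact: g i2.
- exact: c i2. - exact: c i0. - exact: c i1. - exact: z.
Qed.

(** Unordered pairs of basis vectors, sorted by their degree in the grading of the
algebra; the shape in which all brackets below are compared. *)
Lemma basis_pair (P : 'I_7 -> 'I_7 -> Prop) :
  (forall k, P k k) -> (forall k l, P k l -> P l k) ->
  (forall j, P (gen (nxt j)) (gen (nxt (nxt j)))) ->
  (forall i j, P (gen i) (com j)) -> (forall i, P (gen i) ctr) ->
  (forall i j, P (com i) (com j)) -> (forall i, P (com i) ctr) ->
  forall k l, P k l.
Proof.
move=> d s gg gc gz cc cz.
have gg' i j : P (gen i) (gen j) by move: i j; apply: ord3_pair => [i|j|j] //; apply/s.
elim/ord7_ind => [i|i|]; elim/ord7_ind => [j|j|] //; apply/s => //.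
Qed.

Definition genv (R : realType) (i : 'I_3) : 'rV[R]_7 := delta_mx 0 (gen i).
Definition comv (R : realType) (j : 'I_3) : 'rV[R]_7 := delta_mx 0 (com j).
Definition ctrv (R : realType) : 'rV[R]_7 := delta_mx 0 ctr.

Section Model.
Variable R : realType.
Implicit Types (N M A : 'M[R]_3) (x y z u : 'rV[R]_7) (f : 'M[R]_7).

Local Notation X := (@genv R).
Local Notation W := (@comv R).
Local Notation G := (@ctrv R).

Lemma gen_inj : injective gen. Proof. by elim/ord3_ind; elim/ord3_ind. Qed.
Lemma com_inj : injective com. Proof. by elim/ord3_ind; elim/ord3_ind. Qed.
Lemma gen_com i j : (gen i == com j) = false.
Proof. by move: i j; elim/ord3_ind; elim/ord3_ind. Qed.
Lemma gen_ctr i : (gen i == ctr) = false. Proof. by elim/ord3_ind: i. Qed.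
Lemma com_ctr i : (com i == ctr) = false. Proof. by elim/ord3_ind: i. Qed.

Lemma coordXX i k : X i 0 (gen k) = (k == i)%:R.
Proof. by rewrite mxE eqxx (inj_eq gen_inj). Qed.
Lemma coordXW i k : X i 0 (com k) = 0.
Proof. by rewrite mxE eqxx eq_sym gen_com. Qed.
Lemma coordXG i : X i 0 ctr = 0.
Proof. by rewrite mxE eqxx eq_sym gen_ctr. Qed.
Lemma coordWX i k : W i 0 (gen k) = 0.
Proof. by rewrite mxE eqxx gen_com. Qed.
Lemma coordWW i k : W i 0 (com k) = (k == i)%:R.
Proof. by rewrite mxE eqxx (inj_eq com_inj). Qed.
Lemma coordWG i : W i 0 ctr = 0.
Proof. by rewrite mxE eqxx eq_sym com_ctr. Qed.
Lemma coordGX k : G 0 (gen k) = 0.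
Proof. by rewrite mxE eqxx gen_ctr. Qed.
Lemma coordGW k : G 0 (com k) = 0.
Proof. by rewrite mxE eqxx com_ctr. Qed.
Lemma coordGG : G 0 ctr = 1.
Proof. by rewrite mxE !eqxx. Qed.

Lemma coordD x y k : (x + y) 0 k = x 0 k + y 0 k. Proof. by rewrite mxE. Qed.
Lemma coordN x k : (- x) 0 k = - x 0 k. Proof. by rewrite mxE. Qed.
Lemma coordZ a x k : (a *: x) 0 k = a * x 0 k. Proof. by rewrite mxE. Qed.

Lemma coord0 k : (0 : 'rV[R]_7) 0 k = 0. Proof. by rewrite mxE. Qed.

Definition coordE := (coord0, coordD, coordN, coordZ, coordXX, coordXW, coordXG,
  coordWX, coordWW, coordWG, coordGX, coordGW, coordGG).

Lemma vecP x y : (forall i, x 0 (gen i) = y 0 (gen i)) ->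
  (forall j, x 0 (com j) = y 0 (com j)) -> x 0 ctr = y 0 ctr -> x = y.
Proof. by move=> g c z; apply/rowP; apply: ord7_ind. Qed.

(** The wedge of the generator parts of [x] and [y], in the basis bc, ca, ab. *)
Definition cross x y (j : 'I_3) : R :=
  x 0 (gen (nxt j)) * y 0 (gen (nxt (nxt j))) - x 0 (gen (nxt (nxt j))) * y 0 (gen (nxt j)).

(** The brackets with values in the line of g that vanish unless one argument is a
generator and the other is one of e, f, d; they are the tangent directions to the
space of models. *)
Definition central M : bilin R 7 := \sum_i \sum_j wedge (gen i) (com j) (M i j *: G).
Definition model N : bilin R 7 :=
  \sum_j wedge (gen (nxt j)) (gen (nxt (nxt j))) (W j) + central N.

Definition pairing M x y : R :=
  \sum_i \sum_j M i j * (x 0 (gen i) * y 0 (com j) - x 0 (com j) * y 0 (gen i)).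

Lemma br_central M x y : br (central M) x y = pairing M x y *: G.
Proof.
rewrite /central br_summ scaler_suml; apply: eq_bigr => i _.
rewrite br_summ scaler_suml; apply: eq_bigr => j _.
by rewrite br_wedge scalerA mulrC.
Qed.

Lemma br_model N x y :
  br (model N) x y = \sum_j cross x y j *: W j + pairing N x y *: G.
Proof.
rewrite /model brDm br_central br_summ; congr (_ + _).
by apply: eq_bigr => j _; rewrite br_wedge.
Qed.

Lemma br_model_gen N x y i : br (model N) x y 0 (gen i) = 0.
Proof. by rewrite br_model sum3 !coordE !mulr0 !addr0. Qed.
Lemma br_model_com N x y j : br (model N) x y 0 (com j) = cross x y j.
Proof.
rewrite br_model sum3 !coordE.
by elim/ord3_ind: j; rewrite /= !mulr0 !mulr1 !addr0 ?add0r.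
Qed.
Lemma br_model_ctr N x y : br (model N) x y 0 ctr = pairing N x y.
Proof.
by rewrite br_model sum3 !coordE !mulr0 !add0r mulr1.
Qed.

Lemma alt_central M : alternating (central M).
Proof.
move=> x; rewrite br_central /pairing big1 ?scale0r // => i _; rewrite big1 // => j _.
by rewrite [X in _ - X]mulrC subrr mulr0.
Qed.
Lemma alt_model N : alternating (model N).
Proof.
move=> x; rewrite /model brDm alt_central addr0 br_summ big1 // => j _.
by rewrite br_wedge mulrC subrr scale0r.
Qed.

Lemma pairing_com M u z : (forall i, u 0 (gen i) = 0) ->
  pairing M u z = - \sum_i \sum_j M i j * (z 0 (gen i) * u 0 (com j)).
Proof.
move=> u0; rewrite /pairing -sumrN; apply: eq_bigr => i _; rewrite -sumrN.
by apply: eq_bigr => j _; rewrite u0; ring.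
Qed.

Lemma br_model_com_l N u z : (forall i, u 0 (gen i) = 0) ->
  br (model N) u z = pairing N u z *: G.
Proof.
move=> u0; rewrite br_model big1 ?add0r // => j _.
by rewrite /cross !u0 !mul0r subr0 scale0r.
Qed.

Lemma br_br_model N x y z : br (model N) (br (model N) x y) z =
  pairing N (br (model N) x y) z *: G.
Proof. by apply: br_model_com_l => i; exact: br_model_gen. Qed.

Lemma pairingGl M z : pairing M G z = 0.
Proof.
rewrite pairing_com => [|i]; last by rewrite coordE.
by rewrite big1 ?oppr0 // => i _; rewrite big1 // => j _; rewrite coordE !mulr0.
Qed.

Lemma pairingZl M a u z : pairing M (a *: u) z = a * pairing M u z.
Proof.
rewrite /pairing mulr_sumr; apply: eq_bigr => i _; rewrite mulr_sumr.
by apply: eq_bigr => j _; rewrite !mxE; ring.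
Qed.

(** A generator [x] and a product [y] /\ [z] pair to the entry of a matrix, and the
cyclic sum over [x], [y], [z] is minus the trace times the determinant of the three
generator parts.  This is where tracelessness enters the Jacobi identity and its
linearisation. *)
Lemma cyclic_trace N M x y z : pairing M (br (model N) x y) z +
  pairing M (br (model N) y z) x + pairing M (br (model N) z x) y =
  - \tr M * (x 0 (gen i0) * cross y z i0 + x 0 (gen i1) * cross y z i1 +
           x 0 (gen i2) * cross y z i2).
Proof.
rewrite !pairing_com; try exact: br_model_gen.
rewrite !sum3 !br_model_com /mxtrace sum3 /cross /=; ring.
Qed.

Lemma GbrN N z : br (model N) G z = 0.
Proof. by rewrite br_model_com_l ?pairingGl ?scale0r // => i; rewrite coordE. Qed.

Lemma model_nilvar N : \tr N = 0 -> nilvar R 7 3 (model N).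
Proof.
move=> tN; split; first exact: alt_model.
- move=> x y z; rewrite /jacobiator !br_br_model -!scalerDl.
  by rewrite cyclic_trace tN oppr0 mul0r scale0r.
by move=> x /=; rewrite (br_br_model N (x 0) (x 1)) brZl GbrN scaler0.
Qed.

Lemma central_Z2nil N M : \tr M = 0 -> Z2nil 3 (model N) (central M).
Proof.
move=> tM; split; split; try exact: alt_central.
  move=> x y z; rewrite d2_linJ; try exact: alt_model; last exact: alt_central.
  rewrite !br_central !brZl !GbrN !scaler0 !addr0 -!scalerDl cyclic_trace.
  by rewrite tM oppr0 mul0r scale0r oppr0.
move=> x; rewrite diff_Nk /= !br0l !addr0 !brDl !br_central !brZl !GbrN !br0l
  !scaler0 ?br0l !addr0.
by rewrite br_br_model pairingZl pairingGl mulr0 scale0r.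
Qed.

End Model.

(** * Cocycles of a model modulo coboundaries *)
Section Cohomology.
Variable R : realType.
Implicit Types (N M A : 'M[R]_3) (x y z u : 'rV[R]_7) (f : 'M[R]_7).
Local Notation X := (@genv R).
Local Notation W := (@comv R).
Local Notation G := (@ctrv R).

(** The linear map sending a, b, c to [X'], bc, ca, ab to [W'] and g to [G'];
the order of the list is that of the basis a, b, c, d, e, f, g. *)
Definition frame_mx (X' W' : 'I_3 -> 'rV[R]_7) (G' : 'rV[R]_7) : 'M[R]_7 :=
  \matrix_(k < 7) nth 0 [:: X' i0; X' i1; X' i2; W' i2; W' i0; W' i1; G'] k.

Lemma frameX X' W' G' i : X i *m frame_mx X' W' G' = X' i.
Proof. by rewrite /genv -rowE rowK; elim/ord3_ind: i. Qed.
Lemma frameW X' W' G' i : W i *m frame_mx X' W' G' = W' i.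
Proof. by rewrite /comv -rowE rowK; elim/ord3_ind: i. Qed.
Lemma frameG X' W' G' : G *m frame_mx X' W' G' = G'.
Proof. by rewrite /ctrv -rowE rowK. Qed.

Lemma alt_ext (s s' : bilin R 7) : alternating s -> alternating s' ->
  (forall j, br s (X (nxt j)) (X (nxt (nxt j))) = br s' (X (nxt j)) (X (nxt (nxt j)))) ->
  (forall i j, br s (X i) (W j) = br s' (X i) (W j)) ->
  (forall i, br s (X i) G = br s' (X i) G) ->
  (forall i j, br s (W i) (W j) = br s' (W i) (W j)) ->
  (forall i, br s (W i) G = br s' (W i) G) -> s = s'.
Proof.
move=> As As' XX XW XG WW WG; apply: br_ext; apply: basis_pair => //.
  by move=> k; rewrite As As'.
by move=> k l E; rewrite (br_alt _ _ As) E -(br_alt _ _ As').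
Qed.

Lemma pairingX M i u :
  pairing M (X i) u = \sum_k M i k * u 0 (com k).
Proof.
rewrite /pairing (bigD1 i) //= addrC big1 ?add0r => [|k nik].
  by apply: eq_bigr => k _; rewrite !coordE eqxx mul1r mul0r subr0.
by rewrite big1 // => l _; rewrite !coordE (negPf nik) !mul0r subr0 mulr0.
Qed.

Lemma pairingXX M i j : pairing M (X i) (X j) = 0.
Proof. by rewrite pairingX big1 // => k _; rewrite coordE mulr0. Qed.

Lemma modelXX N j : br (model N) (X (nxt j)) (X (nxt (nxt j))) = W j.
Proof.
apply: vecP => [i|i|]; rewrite ?br_model_gen ?br_model_com ?br_model_ctr !coordE //.
  rewrite /cross !coordE; elim/ord3_ind: j; elim/ord3_ind: i;
  by rewrite /= ?mulr0 ?mul0r ?mulr1 ?subr0.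
by rewrite pairingXX.
Qed.

Lemma pairingW M j u :
  pairing M (W j) u = - \sum_k M k j * u 0 (gen k).
Proof.
rewrite pairing_com => [|i]; last by rewrite coordE.
congr (- _); apply: eq_bigr => i _; rewrite (bigD1 j) //= big1 => [|k nik].
  by rewrite !coordE eqxx mulr1 addr0.
by rewrite !coordE (negPf nik) !mulr0.
Qed.

Lemma pairingXW M i j : pairing M (X i) (W j) = M i j.
Proof.
rewrite pairingX (bigD1 j) //= big1 => [|k nik].
  by rewrite !coordE eqxx mulr1 addr0.
by rewrite !coordE (negPf nik) !mulr0.
Qed.

Lemma pairing0 M u z :
  (forall i, z 0 (gen i) = 0) -> (forall j, u 0 (gen j) = 0) -> pairing M u z = 0.
Proof.
move=> z0 u0; rewrite pairing_com // big1 ?oppr0 // => i _; rewrite big1 // => j _.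
by rewrite z0 mul0r mulr0.
Qed.

Lemma modelWl N j u : br (model N) (W j) u = pairing N (W j) u *: G.
Proof. by apply: br_model_com_l => i; rewrite coordE. Qed.

Lemma modelXW N i j : br (model N) (X i) (W j) = N i j *: G.
Proof.
rewrite (br_alt _ _ (alt_model N)) modelWl pairingW -scaleNr opprK; congr (_ *: _).
rewrite (bigD1 i) //= big1 => [|k nik].
  by rewrite !coordE eqxx mulr1 addr0.
by rewrite !coordE (negPf nik) !mulr0.
Qed.

Lemma modelWW N i j : br (model N) (W i) (W j) = 0.
Proof. by rewrite modelWl pairing0 ?scale0r // => k; rewrite coordE. Qed.

Lemma modelG N u : br (model N) u G = 0.
Proof. by rewrite (br_alt _ _ (alt_model N)) GbrN oppr0. Qed.

Lemma pairingGr M u : pairing M u G = 0.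
Proof.
rewrite /pairing big1 // => i _; rewrite big1 // => j _.
by rewrite !coordE !mulr0 subr0 mulr0.
Qed.

(** A central vector has no generator part because brackets of two generators are
independent, and no part in degree two because [N] is invertible. *)
Lemma model_centre N u : N \in unitmx ->
  (forall y, br (model N) u y = 0) -> u = u 0 ctr *: G.
Proof.
move=> Nu H.
have u0 i : u 0 (gen i) = 0.
  have E j k : br (model N) u (X j) 0 (com k) = 0 by rewrite H mxE.
  have := E i1 i2; have := E i2 i0; have := E i0 i1.
  rewrite !br_model_com /cross !coordE /= !(mulr0, mulr1, subr0, sub0r, add0r).
  by elim/ord3_ind: i => // /eqP e1 /eqP e2 /eqP e3; apply/eqP; rewrite -oppr_eq0.
have w0 : \row_j u 0 (com j) = 0.
  have Ntu : N^T \in unitmx by rewrite unitmx_tr.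
  rewrite -[LHS](mulmxK Ntu) [X in X *m _](_ : _ = 0) ?mul0mx //.
  apply/rowP => i; have := congr1 (fun v : 'rV_7 => v 0 ctr) (H (X i)).
  rewrite br_model_ctr pairing_com // coord0 => /eqP; rewrite oppr_eq0 => /eqP e.
  rewrite [RHS]mxE -e [LHS]mxE [RHS](bigD1 i) //= [X in _ = _ + X]big1 => [|k nik].
    rewrite addr0; apply: eq_bigr => j _; rewrite coordE eqxx mul1r !mxE; exact: mulrC.
  by rewrite big1 // => j _; rewrite coordE (negPf nik) mul0r mulr0.
apply: vecP => [i|i|]; rewrite !coordE ?mulr0 ?mulr1 //.
by have /rowP/(_ i) := w0; rewrite !mxE.
Qed.

Lemma d1_frame_mx N X' W' G' f : f = frame_mx X' W' G' ->
  [/\ forall j, d1 (model N) f (X (nxt j)) (X (nxt (nxt j))) =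
        br (model N) (X (nxt j)) (X' (nxt (nxt j)))
        - br (model N) (X (nxt (nxt j))) (X' (nxt j)) - W' j,
      forall i j, d1 (model N) f (X i) (W j) =
        br (model N) (X i) (W' j) - br (model N) (W j) (X' i) - N i j *: G',
      forall i, d1 (model N) f (X i) G = br (model N) (X i) G' - br (model N) G (X' i),
      forall i j, d1 (model N) f (W i) (W j) =
        br (model N) (W i) (W' j) - br (model N) (W j) (W' i)
    & forall i, d1 (model N) f (W i) G = br (model N) (W i) G' - br (model N) G (W' i)].
Proof.
move=> ->; split=> *; rewrite /d1 ?modelXX ?modelXW ?modelWW ?modelG ?mul0mx ?subr0;
  by rewrite ?frameX ?frameW ?frameG // -scalemxAl frameG.
Qed.

(** A coboundary makes the cocycle vanish on pairs of generators and on the pair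
([p], [q]).  The linearised nilpotency condition then makes g central for the
cocycle and forces the remaining values into the centre of the model, and the
linearised Jacobi identity kills the values on pairs of degree two and gives the
trace condition. *)
Lemma Z2nil_normal_form N p q tau : N \in unitmx -> \tr N = 0 -> N p q != 0 ->
  Z2nil 3 (model N) tau ->
  exists f M, \tr M = 0 /\ tau = coboundary (model N) f + central M.
Proof.
move=> Nu tN Npq Ztau.
pose W' j := - br tau (X (nxt j)) (X (nxt (nxt j))).
pose f := frame_mx (fun=> 0) W' ((N p q)^-1 *: (br (model N) (X p) (W' q) - br tau (X p) (W q))).
have [fXX fXW fXG fWW fWG] := d1_frame_mx N (erefl f).
pose t := tau + (-1) *: coboundary (model N) f.
have Zt : Z2nil 3 (model N) t.
  apply: Z2nilD => //; apply: Z2nilZ; apply: d1_Z2nil; exact: model_nilvar.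
have tE u v : br t u v = br tau u v - d1 (model N) f u v.
  by rewrite /t brDm brZm scaleN1r coboundaryE.
have [[At Jt] [_ Nt]] := Zt.
have tXX' j : br t (X (nxt j)) (X (nxt (nxt j))) = 0.
  by rewrite tE fXX !br0r subrr sub0r opprK /W' subrr.
have tXX i j : br t (X i) (X j) = 0.
  move: i j; apply: ord3_pair => // j.
  by rewrite (br_alt _ _ At) tXX' oppr0.
have tpq : br t (X p) (W q) = 0.
  rewrite tE fXW br0r subr0 scalerA mulfV // scale1r.
  by rewrite subKr subrr.
(* The linearised nilpotency condition on the arguments whose first bracket is W j. *)
have E j u v : br t (br (model N) (W j) u) v + br (model N) (br t (W j) u) v = 0.
  pose x k := match k with 0%N => X (nxt j) | 1%N => X (nxt (nxt j)) | 2%N => u | _ => v end.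
  have := Nt x; rewrite diff_Nk /= br0l addr0.
  by rewrite tXX' br0l addr0 modelXX.
have WX i j : br (model N) (W j) (X i) = (- N i j) *: G.
  by rewrite (br_alt _ _ (alt_model N)) modelXW scaleNr.
have tG v : br t G v = 0.
  have := E q (X p) v; rewrite WX (br_alt (X p) (W q) At) tpq oppr0 br0l addr0 brZl.
  by move/eqP; rewrite scaler_eq0 oppr_eq0 (negPf Npq) => /eqP.
have tuG v : br t v G = 0 by rewrite (br_alt _ _ At) tG oppr0.
pose M : 'M[R]_3 := \matrix_(i, j) br t (X i) (W j) 0 ctr.
have tXW i j : br t (X i) (W j) = M i j *: G.
  rewrite mxE; apply: (model_centre Nu) => v.
  have := E j (X i) v; rewrite WX brZl tG scaler0 add0r (br_alt (X i) (W j) At).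
  by rewrite brNl => /eqP; rewrite oppr_eq0 => /eqP.
have tWX i j : br t (W j) (X i) = - M i j *: G.
  by rewrite (br_alt _ _ At) tXW scaleNr.
have tWW i j : br t (W i) (W j) = 0.
  have c : br t (W i) (W j) = br t (W i) (W j) 0 ctr *: G.
    apply: (model_centre Nu) => v.
    by have := E i (W j) v; rewrite modelWW br0l add0r.
  have := Jt (X (nxt i)) (X (nxt (nxt i))) (W j).
  rewrite d2_linJ //; last exact: alt_model.
  rewrite !tXW !tWX modelXX modelXW (WX (nxt i)) !brZl !tG !GbrN tXX' br0l.
  by rewrite !scaler0 !addr0 => /eqP; rewrite oppr_eq0 => /eqP.
have trM : \tr M = 0.
  have := Jt (X i0) (X i1) (X i2).
  rewrite d2_linJ //; last exact: alt_model.
  have mXX := modelXX N; rewrite (mXX i0) (mXX i1) (mXX i2) !tXX !br0l !addr0 !tWX.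
  move/(congr1 (fun v : 'rV[R]_7 => v 0 ctr)); rewrite !coordE !mulr1.
  rewrite /mxtrace sum3; move: (M i0 i0) (M i1 i1) (M i2 i2) => a b c; lra.
exists f, M; split=> //.
suff <- : t = central M by rewrite /t scaleN1r addrC subrK.
apply: alt_ext => // [|j|i j|i|i j|i]; first exact: alt_central.
all: rewrite br_central ?pairingGr ?tuG ?tXX ?tWW ?scale0r //.
- by rewrite pairingXX scale0r.
- by rewrite pairingXW.
- by rewrite pairing0 ?scale0r // => k; rewrite coordE.
Qed.

(** The action of [f] on generators is a matrix [A]; on degree two it is forced to
act as Lambda^2 A, which in the dual basis is tr A - A^T.  Comparing brackets in
degree three yields the commutator, and the scalar collects tr A and the
action on g. *)
Lemma central_B2 N M f : central M = coboundary (model N) f ->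
  exists A r, M = A *m N - N *m A + r *: N.
Proof.
move=> H.
pose X' i := X i *m f; pose W' i := W i *m f.
have WE j : W' j =
    br (model N) (X (nxt j)) (X' (nxt (nxt j))) - br (model N) (X (nxt (nxt j))) (X' (nxt j)).
  have := coboundaryE (model N) f (X (nxt j)) (X (nxt (nxt j))); rewrite -H br_central.
  by rewrite pairingXX scale0r /d1 modelXX => /esym/eqP; rewrite subr_eq0 => /eqP.
have [A AE] : exists A : 'M[R]_3, forall i j, X' i 0 (gen j) = A i j.
  by exists (\matrix_(i, j) X' i 0 (gen j)) => i j; rewrite [RHS]mxE.
exists A, (\tr A - (G *m f) 0 ctr); apply/matrixP => i j.
have := coboundaryE (model N) f (X i) (W j); rewrite -H br_central pairingXW /d1 modelXW.
move/(congr1 (fun v : 'rV[R]_7 => v 0 ctr)); rewrite -scalemxAl !coordE mulr1.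
rewrite !br_model_ctr pairingX pairingW => ->.
have WfE k : (W j *m f) 0 (com k) = (\tr A) * (k == j)%:R - A k j.
  rewrite -[W j *m f]/(W' j) WE !coordE !br_model_com /cross !coordE !AE /mxtrace sum3.
  by elim/ord3_ind: j; elim/ord3_ind: k; rewrite /=; ring.
rewrite sum3 !WfE -[X i *m f]/(X' i) sum3 !AE !mxE !sum3.
by elim/ord3_ind: j {WfE}; rewrite /=; ring.
Qed.

(** The converse uses the derivation-like extension of [A] to degrees two and
three, with the action on g shifted by [r]. *)
Lemma B2_central N A r : exists f,
  coboundary (model N) f = central (A *m N - N *m A + r *: N).
Proof.
pose X' i := \sum_k A i k *: X k.
pose W' j := \sum_k (\tr A * (k == j)%:R - A k j) *: W k.
pose f := frame_mx X' W' ((\tr A - r) *: G); exists f.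
have [fXX fXW fXG fWW fWG] := d1_frame_mx N (erefl f).
have XW' i j : br (model N) (X i) (W' j) =
    (\sum_k (\tr A * (k == j)%:R - A k j) * N i k) *: G.
  rewrite br_sumr scaler_suml; apply: eq_bigr => k _.
  by rewrite brZr modelXW scalerA.
have WX' i j : br (model N) (W j) (X' i) = (- \sum_k A i k * N k j) *: G.
  rewrite br_sumr -sumrN scaler_suml; apply: eq_bigr => k _.
  by rewrite brZr (br_alt _ _ (alt_model N)) modelXW scalerN scalerA scaleNr.
have WW' i j : br (model N) (W i) (W' j) = 0.
  by rewrite br_sumr big1 // => k _; rewrite brZr modelWW scaler0.
have GX' i : br (model N) G (X' i) = 0 by rewrite GbrN.
apply: alt_ext => [||j|i j|i|i j|i].
- exact/d1_alternating/alt_model.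
- exact: alt_central.
all: rewrite coboundaryE br_central.
- rewrite fXX; apply: vecP => [i|i|].
  + rewrite !coordE !br_model_gen /W' sum3 !coordE mulr0 subrr sub0r; ring.
  + rewrite !coordE !br_model_com /cross /X' /W' !sum3 !coordE /mxtrace sum3.
    by elim/ord3_ind: j; elim/ord3_ind: i; rewrite /=; ring.
  rewrite !coordE !br_model_ctr pairingXX !pairingX /X' /W' !sum3 !coordE.
  ring.
- rewrite fXW XW' WX' scalerA -!scalerBl pairingXW; congr (_ *: _).
  by rewrite !mxE !sum3 /mxtrace sum3; elim/ord3_ind: j; rewrite /=; ring.
- by rewrite fXG GX' brZr modelG scaler0 subr0 pairingGr scale0r.
- by rewrite fWW !WW' subr0 pairing0 ?scale0r // => k; rewrite coordE.
by rewrite fWG GbrN brZr modelG scaler0 subr0 pairingGr scale0r.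
Qed.

End Cohomology.

(** * The two families as curves of matrices *)
Section Families.
Variable R : realType.
Implicit Types (N M A K : 'M[R]_3) (t : R).

Lemma central_linear : linear (@central R).
Proof.
move=> a M M'; apply: br_ext => i j; rewrite brDm brZm !br_central scalerA -scalerDl.
congr (_ *: _); rewrite /pairing mulr_sumr -big_split; apply: eq_bigr => k _ /=.
by rewrite mulr_sumr -big_split; apply: eq_bigr => l _ /=; rewrite !mxE; ring.
Qed.

HB.instance Definition _ := GRing.isLinear.Build _ _ _ _ _ central_linear.

Definition mx3 (a b c d e f g h k : R) : 'M[R]_3 :=
  \matrix_(i, j) nth 0 (nth [::] [:: [:: a; b; c]; [:: d; e; f]; [:: g; h; k]] i) j.

Lemma mx3E M : M = mx3 (M i0 i0) (M i0 i1) (M i0 i2) (M i1 i0) (M i1 i1) (M i1 i2)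
  (M i2 i0) (M i2 i1) (M i2 i2).
Proof. by apply/matrixP; elim/ord3_ind; elim/ord3_ind; rewrite !mxE. Qed.

Lemma det3 M : \det M = M i0 i0 * (M i1 i1 * M i2 i2 - M i1 i2 * M i2 i1)
  - M i0 i1 * (M i1 i0 * M i2 i2 - M i1 i2 * M i2 i0)
  + M i0 i2 * (M i1 i0 * M i2 i1 - M i1 i1 * M i2 i0).
Proof.
rewrite [in LHS](mx3E M) (expand_det_row _ i0) sum3 /cofactor.
rewrite !(expand_det_row _ (0 : 'I_2)) !big_ord_recl !big_ord0 /cofactor !det_mx11.
by rewrite !mxE /=; ring.
Qed.

(** The cohomology of a model is sl_3 modulo commutators with [N] and multiples of
[N]: [K] is a basis of a complement. *)
Lemma dim_H2_model N p q d (K : d.-tuple 'M[R]_3) :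
  \det N != 0 -> \tr N = 0 -> N p q != 0 -> (forall i, \tr (tnth K i) = 0) ->
  (forall M, \tr M = 0 -> exists A r (c : 'I_d -> R),
     M = A *m N - N *m A + r *: N + \sum_i c i *: tnth K i) ->
  (forall (c : 'I_d -> R) A r,
     \sum_i c i *: tnth K i = A *m N - N *m A + r *: N -> forall i, c i = 0) ->
  dim_H2nil 3 (model N) d.
Proof.
move=> dN tN Npq tK gen indep.
have Nu : N \in unitmx by rewrite unitmxE unitfE.
apply: (@dim_H2nil_complement _ _ _ _ _ (map_tuple (@central R) K)).
- exact: model_nilvar.
- by move=> i; rewrite tnth_map; apply: central_Z2nil.
- move=> tau /(Z2nil_normal_form Nu tN Npq)[f [M [/gen[A [r [c ->]]] ->]]].
  have [f' f'E] := B2_central N A r; exists (f + f'), c.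
  rewrite linearD /= -f'E linear_sum addrA; congr (_ + _); last first.
    by apply: eq_bigr => i _; rewrite linearZ /= tnth_map.
  by have := coboundary_linear (model N) 1 f f'; rewrite !scale1r => ->.
move=> c f H; have [|A [r E]] := @central_B2 _ N (\sum_i c i *: tnth K i) f; last exact: indep E.
by rewrite -H linear_sum; apply: eq_bigr => i _; rewrite linearZ /= tnth_map.
Qed.

Definition mx147E t : 'M[R]_3 := mx3 (-1) 0 0 0 t 0 0 0 (1 - t).
Definition mx147E1 t : 'M[R]_3 := mx3 0 (- t) 0 t 2 0 0 0 (- 2).
(** The derivatives in t of the two curves of matrices. *)
Definition d147E : 'M[R]_3 := mx3 0 0 0 0 1 0 0 0 (- 1).
Definition d147E1 : 'M[R]_3 := mx3 0 (- 1) 0 1 0 0 0 0 0.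

Lemma g147E_model t : g147E t = model (mx147E t).
Proof.
apply: br_ext => i j; move: (delta_mx _ _) (delta_mx _ _) => x y.
rewrite br_model /g147E !brDm !br_wedge sum3 /pairing !sum3 !mxE /= /cross /=.
rewrite -[delta_mx 0 (@Ordinal 7 3 isT)]/(comv R i2) -[delta_mx 0 (@Ordinal 7 4 isT)]/(comv R i0).
rewrite -[delta_mx 0 (@Ordinal 7 5 isT)]/(comv R i1) -[delta_mx 0 (@Ordinal 7 6 isT)]/(ctrv R).
rewrite /gen /com /=; move: (comv R i0) (comv R i1) (comv R i2) (ctrv R) => e f d g.
by apply/rowP => k; rewrite !mxE; ring.
Qed.

Lemma g147E1_model t : g147E1 t = model (mx147E1 t).
Proof.
apply: br_ext => i j; move: (delta_mx _ _) (delta_mx _ _) => x y.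
rewrite br_model /g147E1 !brDm !br_wedge sum3 /pairing !sum3 !mxE /= /cross /=.
rewrite -[delta_mx 0 (@Ordinal 7 3 isT)]/(comv R i2) -[delta_mx 0 (@Ordinal 7 4 isT)]/(comv R i0).
rewrite -[delta_mx 0 (@Ordinal 7 5 isT)]/(comv R i1) -[delta_mx 0 (@Ordinal 7 6 isT)]/(ctrv R).
rewrite /gen /com /=; move: (comv R i0) (comv R i1) (comv R i2) (ctrv R) => e f d g.
by apply/rowP => k; rewrite !mxE; ring.
Qed.

Lemma modelD N M : model (N + M) = model N + central M.
Proof. by rewrite /model linearD /= addrA. Qed.

Lemma is_diff_affine (V : normedModType R) (u v : V) (t : R) :
  is_diff t (fun s : R => u + s *: v) ( *:%R ^~ v).
Proof.
have := is_diffD (is_diff_cst u t) (is_diff_scalel t v).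
by rewrite add0r.
Qed.

Lemma affine_derive1 (V : normedModType R) (u v : V) (t : R) (f : R -> V) :
  (f = fun s => u + s *: v) -> derive1 f t = v /\ {for t, continuous f}.
Proof.
move=> ->; have D := is_diff_affine u v t; split.
  by rewrite derive1E' // diff_val scale1r.
exact: differentiable_continuous.
Qed.

Lemma g147E_affine : @g147E R = fun t => model (mx147E 0) + t *: central d147E.
Proof.
apply/funext => t; rewrite g147E_model -linearZ -modelD; congr model.
by apply/matrixP; elim/ord3_ind; elim/ord3_ind; rewrite !mxE /=; ring.
Qed.

Lemma g147E1_affine : @g147E1 R = fun t => model (mx147E1 0) + t *: central d147E1.
Proof.
apply/funext => t; rewrite g147E1_model -linearZ -modelD; congr model.
by apply/matrixP; elim/ord3_ind; elim/ord3_ind; rewrite !mxE /=; ring.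
Qed.

Lemma det_mx147E t : \det (mx147E t) = t * (t - 1).
Proof. by rewrite det3 !mxE /=; ring. Qed.
Lemma det_mx147E1 t : \det (mx147E1 t) = - 2 * t ^+ 2.
Proof. by rewrite det3 !mxE /=; ring. Qed.
Lemma tr_mx147E t : \tr (mx147E t) = 0.
Proof. by rewrite /mxtrace sum3 !mxE /=; ring. Qed.
Lemma tr_mx147E1 t : \tr (mx147E1 t) = 0.
Proof. by rewrite /mxtrace sum3 !mxE /=; ring. Qed.
Lemma tr_d147E : \tr d147E = 0.
Proof. by rewrite /mxtrace sum3 !mxE /=; ring. Qed.
Lemma tr_d147E1 : \tr d147E1 = 0.
Proof. by rewrite /mxtrace sum3 !mxE /=; ring. Qed.

(** A commutator with a diagonal matrix has zero diagonal, so on the diagonal only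
the multiple of diag(-1, t, 1-t) survives. *)
Lemma d147E_indep t c A r :
  c *: d147E = A *m mx147E t - mx147E t *m A + r *: mx147E t -> c = 0.
Proof.
move/matrixP => E; have := E i0 i0; have := E i1 i1.
rewrite !mxE !sum3 !mxE /= => e1 e2; nra.
Qed.

(** The corner entry kills the multiple of the matrix itself.  The upper left block
of a commutator is symmetric as soon as its diagonal vanishes, while that of the
derivative is antisymmetric. *)
Lemma d147E1_indep t c A r : t != 0 ->
  c *: d147E1 = A *m mx147E1 t - mx147E1 t *m A + r *: mx147E1 t -> c = 0.
Proof.
move=> t0 /matrixP E; have := E i0 i0; have := E i0 i1; have := E i1 i0; have := E i2 i2.
rewrite !mxE !sum3 !mxE /= => e22 e10 e01 e00.
have r0 : r = 0 by lra.
have : t * (A i0 i1 + A i1 i0) = 0 by move: e00; rewrite r0; lra.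
move/eqP; rewrite mulf_eq0 (negPf t0) /= => /eqP q; subst r; lra.
Qed.

End Families.

(** * Dimensions of the cohomology *)
Section Dimensions.
Variable R : realType.
Implicit Types (N M A K : 'M[R]_3) (t : R).

Lemma trace3 M : \tr M = M i0 i0 + M i1 i1 + M i2 i2.
Proof. exact: sum3. Qed.

Lemma dim_H2_147E t : 1 < t -> t != 2 -> dim_H2nil 3 (g147E t) 1.
Proof.
move=> t1 t2; rewrite g147E_model.
apply: (@dim_H2_model _ _ i0 i0 _ [tuple d147E R]).
- by rewrite det_mx147E mulf_neq0 ?subr_eq0; lra.
- exact: tr_mx147E.
- by rewrite !mxE /= oppr_eq0 oner_eq0.
- by move=> i; rewrite ord1 tr_d147E.
- move=> M; rewrite trace3 => trM.
  (* Off the diagonal, divide by the differences of the eigenvalues -1, t, 1-t. *)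
  exists (mx3 0 (M i0 i1 / (t + 1)) (M i0 i2 / (2 - t)) (- M i1 i0 / (t + 1)) 0
    (M i1 i2 / (1 - 2 * t)) (M i2 i0 / (t - 2)) (M i2 i1 / (2 * t - 1)) 0),
   (- M i0 i0), (fun=> M i1 i1 + t * M i0 i0).
  have t2' : t - 2 != 0 by rewrite subr_eq0.
  have e22 : M i2 i2 = - M i0 i0 - M i1 i1 by lra.
  rewrite big_ord1 (mx3E M) e22.
  apply/matrixP; elim/ord3_ind; elim/ord3_ind; rewrite !mxE !sum3 !mxE /=;
  by field; do ?[apply/andP; split]; lra.
move=> c A r; rewrite big_ord1 => /d147E_indep c0 i; by rewrite ord1.
Qed.

(** The eigenvalue -1 of diag(-1, 2, -1) is double, so the two off-diagonal entries
joining its eigenvectors are not reached by commutators. *)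
Lemma dim_H2_147E_2 : dim_H2nil 3 (g147E (2 : R)) 3.
Proof.
rewrite g147E_model.
apply: (@dim_H2_model _ _ i0 i0 _
  [tuple d147E R; delta_mx i0 i2; delta_mx i2 i0]).
- rewrite det_mx147E (_ : 2 * (2 - 1) = 2 :> R); [by rewrite pnatr_eq0 | by ring].
- exact: tr_mx147E.
- by rewrite !mxE /= oppr_eq0 oner_eq0.
- by elim/ord3_ind; rewrite trace3 !mxE /=; ring.
- move=> M; rewrite trace3 => trM.
  exists (mx3 0 (M i0 i1 / 3) 0 (- M i1 i0 / 3) 0
    (- M i1 i2 / 3) 0 (M i2 i1 / 3) 0),
   (- M i0 i0), (fun i => [:: M i1 i1 + 2 * M i0 i0; M i0 i2; M i2 i0]`_i).
  have e22 : M i2 i2 = - M i0 i0 - M i1 i1 by lra.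
  rewrite sum3 (mx3E M) e22.
  apply/matrixP; elim/ord3_ind; elim/ord3_ind; rewrite !mxE !sum3 !mxE /=; by field.
move=> c A r; rewrite sum3 /tnth /= => /matrixP E.
have := E i0 i0; have := E i1 i1; have := E i0 i2; have := E i2 i0.
rewrite !mxE !sum3 !mxE /= => e1 e2 e3 e4.
by elim/ord3_ind; nra.
Qed.

Lemma dim_H2_147E1 t : 1 < t -> dim_H2nil 3 (g147E1 t) 1.
Proof.
move=> t1; rewrite g147E1_model.
have t0 : t != 0 by lra.
have T0 : 8 + t ^+ 2 != 0 by nra.
apply: (@dim_H2_model _ _ i2 i2 _ [tuple d147E1 R]).
- by rewrite det_mx147E1 mulf_neq0 ?expf_neq0 // oppr_eq0; lra.
- exact: tr_mx147E1.
- rewrite !mxE /=; lra.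
- by move=> i; rewrite ord1 tr_d147E1.
- move=> M; rewrite trace3 => trM.
  (* The blocks off the diagonal are solved by inverting the matrix with rows
     (2, -t) and (t, 4), of determinant 8 + t^2; the corner entry gives r, and the
     remaining block determines A and the coefficient of the derivative. *)
  pose r := - M i2 i2 / 2.
  pose s := M i0 i0 / (2 * t) - (M i0 i1 + M i1 i0) / 4.
  exists (mx3 0 (M i0 i0 / (2 * t) + (M i0 i1 + M i1 i0) / 4)
      (- (4 * M i0 i2 + t * M i1 i2) / (8 + t ^+ 2))
      s 0 (- (2 * M i1 i2 - t * M i0 i2) / (8 + t ^+ 2))
      ((4 * M i2 i0 - t * M i2 i1) / (8 + t ^+ 2))
      ((t * M i2 i0 + 2 * M i2 i1) / (8 + t ^+ 2)) 0),
   r, (fun=> M i1 i0 + 2 * s - r * t).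
  have e22 : M i2 i2 = - M i0 i0 - M i1 i1 by lra.
  rewrite big_ord1 (mx3E M) /r /s e22.
  apply/matrixP; elim/ord3_ind; elim/ord3_ind; rewrite !mxE !sum3 !mxE /=;
  by field; rewrite ?t0 ?T0.
move=> c A r; rewrite big_ord1 => /(d147E1_indep t0) c0 i; by rewrite ord1.
Qed.

Lemma tangent_147E t :
  Z2nil 3 (g147E t) (derive1 (@g147E R) t) /\ ~ B2 (g147E t) (derive1 (@g147E R) t).
Proof.
have [-> _] := affine_derive1 t (g147E_affine R).
rewrite g147E_model; split; first exact/central_Z2nil/tr_d147E.
move=> /B2_coboundary[f /central_B2[A [r]]]; rewrite -[X in X = _]scale1r => /d147E_indep.
by move/eqP; rewrite oner_eq0.
Qed.

Lemma tangent_147E1 t : t != 0 ->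
  Z2nil 3 (g147E1 t) (derive1 (@g147E1 R) t) /\ ~ B2 (g147E1 t) (derive1 (@g147E1 R) t).
Proof.
move=> t0; have [-> _] := affine_derive1 t (g147E1_affine R).
rewrite g147E1_model; split; first exact/central_Z2nil/tr_d147E1.
move=> /B2_coboundary[f /central_B2[A [r]]]; rewrite -[X in X = _]scale1r => /(d147E1_indep t0).
by move/eqP; rewrite oner_eq0.
Qed.
End Dimensions.

(** * Normal form of the structures near a model *)
Section NormalForm.
Variable R : realType.
Implicit Types (N M A K : 'M[R]_3) (t : R) (s mu nu : bilin R 7).
Local Notation X := (@genv R).
Local Notation W := (@comv R).
Local Notation G := (@ctrv R).

Lemma isomorphic_trans s mu nu :
  isomorphic s mu -> isomorphic mu nu -> isomorphic s nu.
Proof.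
move=> [f fu Hf] [g gu Hg]; exists (f *m g) => [|x y].
  by rewrite unitmx_mul fu gu.
by rewrite !mulmxA Hf Hg.
Qed.

Lemma mul_frame_mx (X' W' : 'I_3 -> 'rV[R]_7) (G' u : 'rV[R]_7) :
  u *m frame_mx X' W' G' =
  \sum_i u 0 (gen i) *: X' i + \sum_j u 0 (com j) *: W' j + u 0 ctr *: G'.
Proof.
have {1}-> : u = \sum_i u 0 (gen i) *: X i + \sum_j u 0 (com j) *: W j + u 0 ctr *: G.
  apply: vecP => [i|i|]; rewrite !sum3 !coordE.
  - by elim/ord3_ind: i; rewrite /=; ring.
  - by elim/ord3_ind: i; rewrite /=; ring.
  by ring.
rewrite !mulmxDl !mulmx_suml -scalemxAl frameG; congr (_ + _ + _).
  by apply: eq_bigr => i _; rewrite -scalemxAl frameX.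
by apply: eq_bigr => i _; rewrite -scalemxAl frameW.
Qed.

Lemma unitmx_kernel n (Q : 'M[R]_n) :
  (forall v : 'rV_n, v *m Q = 0 -> v = 0) -> Q \in unitmx.
Proof.
move=> H; rewrite unitmxE unitfE; apply/negP => /det0P[v nz /H v0].
by rewrite v0 eqxx in nz.
Qed.

Lemma isomorphic_frame s M X' W' G' : alternating s ->
  frame_mx X' W' G' \in unitmx ->
  (forall j, br s (X' (nxt j)) (X' (nxt (nxt j))) = W' j) ->
  (forall i j, br s (X' i) (W' j) = M i j *: G') ->
  (forall i, br s (X' i) G' = 0) ->
  (forall i j, br s (W' i) (W' j) = 0) ->
  (forall i, br s (W' i) G' = 0) ->
  isomorphic s (model M).
Proof.
move=> As Qu XX XW XG WW WG; set Q := frame_mx _ _ _ in Qu.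
have H k l : br s (delta_mx 0 k *m Q) (delta_mx 0 l *m Q) =
    br (model M) (delta_mx 0 k) (delta_mx 0 l) *m Q.
  move: k l; apply: basis_pair.
  - by move=> k; rewrite As alt_model mul0mx.
  - by move=> k l E; rewrite (br_alt _ _ As) E (br_alt _ _ (alt_model M)) mulNmx opprK.
  - by move=> j; rewrite !frameX XX modelXX frameW.
  - by move=> i j; rewrite frameX frameW XW modelXW -scalemxAl frameG.
  - by move=> i; rewrite frameX frameG XG modelG mul0mx.
  - by move=> i j; rewrite !frameW WW modelWW mul0mx.
  - by move=> i; rewrite frameW frameG WG modelG mul0mx.
have H' x y : br s (x *m Q) (y *m Q) = br (model M) x y *m Q.
  rewrite [x]row_sum_delta [y]row_sum_delta !mulmx_suml !br_suml mulmx_suml.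
  apply: eq_bigr => k _; rewrite !br_sumr mulmx_suml; apply: eq_bigr => l _.
  by rewrite -!scalemxAl !brZl !brZr H -!scalemxAl.
exists (invmx Q); first by rewrite unitmx_inv.
move=> x y; rewrite -{1}(mulmxKV Qu x) -{1}(mulmxKV Qu y) H' mulmxK //.
Qed.

(** For a structure [s] near a model, the vectors [gen_br s j] and [top_br s p q]
complete a, b, c to a basis, and [struct_mx s] is the matrix of [s] in it up to
the scale of the last vector.  All three are polynomial in [s]. *)
Definition gen_br s j := br s (X (nxt j)) (X (nxt (nxt j))).
Definition top_br s p q := br s (X p) (gen_br s q).
Definition struct_mx s : 'M[R]_3 := \matrix_(i, j) br s (X i) (gen_br s j) 0 ctr.

(** Triple brackets are central, and invertibility of [struct_mx s] forces a central
vector to be a multiple of the last basis vector: bracketing it twice with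
generators kills its generator part, and bracketing it once kills its part in
degree two.  So all triple brackets lie on one line; rescaling that line by
the last coordinate gives the matrix [struct_mx s].  The Jacobi identity
gives the trace and the commutation in degree two. *)
Lemma nilvar_normal_form s p q : nilvar R 7 3 s ->
  frame_mx X (gen_br s) (top_br s p q) \in unitmx -> \det (struct_mx s) != 0 ->
  \tr (struct_mx s) = 0 /\ isomorphic s (model (struct_mx s)).
Proof.
case=> As Js Ns Qu dM.
have Mu : struct_mx s \in unitmx by rewrite unitmxE unitfE.
have T x y z w : br s (br s (br s x y) z) w = 0.
  exact: (Ns (fun k => match k with 0%N => x | 1%N => y | 2%N => z | _ => w end)).
have WT j z w : br s (br s (gen_br s j) z) w = 0 by exact: T.
have XWn i j : br s (X i) (gen_br s j) = - br s (gen_br s j) (X i) by exact: br_alt.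
have PT i j w : br s (br s (X i) (gen_br s j)) w = 0.
  by rewrite XWn brNl WT oppr0.
have GT w : br s (top_br s p q) w = 0 by exact: PT.
have inj (c : 'I_3 -> R) : (forall m, br s (\sum_j c j *: gen_br s j) (X m) = 0) ->
    forall j, c j = 0.
  move=> H; pose v := \row_j c j.
  have Mtu : (struct_mx s)^T \in unitmx by rewrite unitmx_tr.
  have v0 : v *m (struct_mx s)^T = 0.
    apply/rowP => m; have := H m; rewrite (br_alt _ _ As) br_sumr => /eqP.
    rewrite oppr_eq0 => /eqP /(congr1 (fun u : 'rV_7 => u 0 ctr)).
    rewrite summxE coord0 => H0; rewrite [RHS]mxE -[RHS]H0 mxE; apply: eq_bigr => j _.
    by rewrite brZr coordE [v _ _]mxE [_^T _ _]mxE [struct_mx s _ _]mxE.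
  move=> j; have := mulmxK Mtu v; rewrite v0 mul0mx => /rowP/(_ j).
  by rewrite !mxE.
have cent u : (forall w, br s u w = 0) -> exists c, u = c *: top_br s p q.
  move=> Hu; have uE := mul_frame_mx X (gen_br s) (top_br s p q)
    (u *m invmx (frame_mx X (gen_br s) (top_br s p q))).
  rewrite mulmxKV // in uE; move: uE; set v := u *m _.
  pose b j := v 0 (com j); pose a i := v 0 (gen i).
  rewrite -/(b _) => uE.
  have E k : \sum_i a i *: br s (X i) (X k) + \sum_j b j *: br s (gen_br s j) (X k) = 0.
    rewrite -[RHS](Hu (X k)) uE !brDl brZl GT scaler0 addr0 !br_suml.
    by congr (_ + _); apply: eq_bigr => i _; rewrite brZl.
  have E2 k m : br s (\sum_i a i *: br s (X i) (X k)) (X m) = 0.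
    have := congr1 (fun u => br s u (X m)) (E k); rewrite brDl br0l.
    rewrite [X in _ + X = _]br_suml [X in _ + X = _]big1 ?addr0 // => j _.
    by rewrite brZl WT scaler0.
  have a0 : forall i, a i = 0.
    have w0 : br s (X i1) (X i2) = gen_br s i0 by [].
    have w1 : br s (X i2) (X i0) = gen_br s i1 by [].
    have w2 : br s (X i0) (X i1) = gen_br s i2 by [].
    have w2' : br s (X i1) (X i0) = - gen_br s i2 by rewrite (br_alt _ _ As) w2.
    have w0' : br s (X i2) (X i1) = - gen_br s i0 by rewrite (br_alt _ _ As) w0.
    (* Bracketing u with X i0 detects a i1 and a i2; with X i1, also a i0. *)
    have h0 := inj (fun j => [:: 0; a i2; - a i1]`_j).
    have h1 := inj (fun j => [:: - a i2; 0; a i0]`_j).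
    have E0 m : br s (\sum_(j < 3) [:: 0; a i2; - a i1]`_j *: gen_br s j) (X m) = 0.
      rewrite -[RHS](E2 i0 m) !sum3 /= As w1 w2' scale0r scaler0 !add0r.
      by rewrite scalerN scaleNr addrC.
    have E1 m : br s (\sum_(j < 3) [:: - a i2; 0; a i0]`_j *: gen_br s j) (X m) = 0.
      rewrite -[RHS](E2 i1 m) !sum3 /= As w2 w0' scale0r scaler0 !addr0.
      by rewrite scalerN scaleNr addrC.
    have A1 : - a i1 = 0 by exact: (h0 E0 i2).
    have A2 : - a i2 = 0 by exact: (h1 E1 i0).
    have A0 : a i0 = 0 by exact: (h1 E1 i2).
    by elim/ord3_ind => //; apply/eqP; rewrite -oppr_eq0; apply/eqP.
  have b0 : forall j, b j = 0.
    apply: inj => m; rewrite -[RHS](E m) [X in _ = X + _]big1 ?add0r.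
      by rewrite br_suml; apply: eq_bigr => j _; rewrite brZl.
    by move=> i _; rewrite a0 scale0r.
  exists (v 0 ctr); rewrite uE !big1 ?add0r // => i _.
    by rewrite -/(b i) b0 scale0r.
  by rewrite -/(a i) a0 scale0r.
pose g := top_br s p q 0 ctr.
have ME i j : br s (X i) (gen_br s j) 0 ctr = struct_mx s i j by rewrite [RHS]mxE.
have g0 : g != 0.
  apply/eqP => g0; move/negP: dM; apply; rewrite (_ : struct_mx s = 0) ?det0 //.
  apply/matrixP => i j; rewrite -ME [RHS]mxE.
  by have [c ->] := cent _ (PT i j); rewrite coordE -/g g0 mulr0.
pose G' := g^-1 *: top_br s p q.
have PE i j : br s (X i) (gen_br s j) = struct_mx s i j *: G'.
  rewrite -ME; have [c ->] := cent _ (PT i j).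
  by rewrite coordE -/g /G' scalerA mulfK.
have WP i j : br s (gen_br s j) (X i) = - struct_mx s i j *: G'.
  by rewrite (br_alt _ _ As) PE scaleNr.
have G'T w : br s G' w = 0 by rewrite brZl GT scaler0.
have wG' w : br s w G' = 0 by rewrite (br_alt _ _ As) G'T oppr0.
have WW i j : br s (gen_br s i) (gen_br s j) = 0.
  have := Js (X (nxt i)) (X (nxt (nxt i))) (gen_br s j).
  by rewrite /jacobiator PT WT !addr0.
split.
  have := Js (X i0) (X i1) (X i2); rewrite /jacobiator.
  rewrite -[br s (X i0) (X i1)]/(gen_br s i2) -[br s (X i1) (X i2)]/(gen_br s i0).
  rewrite -[br s (X i2) (X i0)]/(gen_br s i1) !WP -!scalerDl.
  move=> /(congr1 (fun u : 'rV_7 => u 0 ctr)).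
  rewrite coordZ coord0 /G' coordZ -/g mulVf // mulr1 trace3.
  by move: (struct_mx s i0 i0) (struct_mx s i1 i1) (struct_mx s i2 i2) => a b c; lra.
apply: (@isomorphic_frame _ _ X (gen_br s) G') => //.
apply: unitmx_kernel => v.
pose D := frame_mx X W (g^-1 *: G).
have -> : frame_mx X (gen_br s) G' = D *m frame_mx X (gen_br s) (top_br s p q).
  apply/row_matrixP; apply: ord7_ind => [i|i|]; rewrite !rowE mulmxA.
  - by rewrite -[delta_mx _ _]/(X i) !frameX.
  - by rewrite -[delta_mx _ _]/(W i) !frameW.
  by rewrite -[delta_mx _ _]/G !frameG -scalemxAl frameG.
rewrite mulmxA => /(congr1 (mulmx^~ (invmx (frame_mx X (gen_br s) (top_br s p q))))).
rewrite mulmxK // mul0mx mul_frame_mx => e.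
apply: vecP => [i|i|]; rewrite coord0.
- have := congr1 (fun u : 'rV[R]_7 => u 0 (gen i)) e; rewrite !sum3 !coordE.
  by elim/ord3_ind: i; rewrite /=; lra.
- have := congr1 (fun u : 'rV[R]_7 => u 0 (com i)) e; rewrite !sum3 !coordE.
  by elim/ord3_ind: i; rewrite /=; lra.
have := congr1 (fun u : 'rV[R]_7 => u 0 ctr) e; rewrite !sum3 !coordE.
rewrite !(mulr0, add0r, mulr1) => /eqP; rewrite mulf_eq0 invr_eq0 (negPf g0) orbF.
by move/eqP.
Qed.
End NormalForm.

(** * Classification of traceless matrices up to similarity and scale *)
Section Similarity.
Variable R : realType.
Implicit Types (N M A K : 'M[R]_3) (t r : R).
Local Notation X := (@genv R).
Local Notation W := (@comv R).
Local Notation G := (@ctrv R).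

(** New generators X' = A X have brackets W' = C W, where [C] is the cofactor matrix
of [A], hence A C^T = det A.  The new matrix is A M C^T = det A (A M A^-1), and
any nonzero factor is absorbed by rescaling g. *)
Lemma isomorphic_similar M N A r : A \in unitmx -> r != 0 ->
  r *: (A *m M) = N *m A -> isomorphic (model M) (model N).
Proof.
move=> Au r0 AM.
have dA : \det A != 0 by move: Au; rewrite unitmxE unitfE.
pose X' i := \sum_k A i k *: X k.
pose C : 'M[R]_3 := \matrix_(j, k) cross (X' (nxt j)) (X' (nxt (nxt j))) k.
have X'g i k : X' i 0 (gen k) = A i k.
  by rewrite /X' sum3 !coordE; elim/ord3_ind: k; rewrite /=; ring.
have X'c i k : X' i 0 (com k) = 0.
  by rewrite /X' sum3 !coordE; ring.
have CA : C *m A^T = (\det A)%:M.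
  rewrite det3; apply/matrixP => i j; rewrite mxE sum3 !mxE /cross !X'g.
  by elim/ord3_ind: i; elim/ord3_ind: j; rewrite /= ?mulr1n ?mulr0n; ring.
have AC : A *m C^T = (\det A)%:M by rewrite -[LHS]trmxK trmx_mul trmxK CA tr_scalar_mx.
have Cu : C \in unitmx.
  have : \det C * \det A != 0.
    by rewrite -(det_tr A) -det_mulmx CA det_scalar expf_neq0.
  by rewrite mulf_eq0 negb_or unitmxE unitfE => /andP[].
pose W' j := \sum_k C j k *: W k.
pose G' := (\det A / r) *: G.
have XW i j : br (model M) (X' i) (W' j) = N i j *: G'.
  rewrite br_model big1 ?add0r => [|k _]; last first.
    by rewrite /cross /W' !sum3 !coordE !(mulr0, addr0) subrr scale0r.
  rewrite /G' scalerA; congr (_ *: _).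
  have W'g k : W' j 0 (gen k) = 0 by rewrite /W' sum3 !coordE; ring.
  have W'c k : W' j 0 (com k) = C j k.
    by rewrite /W' sum3 !coordE; elim/ord3_ind: k; rewrite /=; ring.
  have -> : pairing M (X' i) (W' j) = (A *m M *m C^T) i j.
    rewrite /pairing mxE exchange_big; apply: eq_bigr => k _ /=.
    rewrite mxE mulr_suml; apply: eq_bigr => l _.
    by rewrite X'g W'c W'g X'c [C^T _ _]mxE; ring.
  have -> : A *m M = r^-1 *: (N *m A) by rewrite -AM scalerA mulVf // scale1r.
  by rewrite -scalemxAl -mulmxA AC mul_mx_scalar !mxE; ring.
apply: (@isomorphic_frame _ _ _ X' W' G') => //; first exact: alt_model.
- apply: unitmx_kernel => v; rewrite mul_frame_mx => e.
  pose a := \row_i v 0 (gen i); pose b := \row_i v 0 (com i).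
  have a0 : a *m A = 0.
    apply/rowP => k; have := congr1 (fun u : 'rV[R]_7 => u 0 (gen k)) e.
    rewrite /X' /W' !sum3 !coordE; rewrite !mxE sum3 !mxE => <-.
    by elim/ord3_ind: k; rewrite /=; ring.
  have b0 : b *m C = 0.
    apply/rowP => k; have := congr1 (fun u : 'rV[R]_7 => u 0 (com k)) e.
    rewrite /X' /W' !sum3 !coordE => ek.
    rewrite [RHS]mxE -ek mxE sum3 ![b _ _]mxE.
    by elim/ord3_ind: k {ek}; rewrite /=; ring.
  have {}a0 : a = 0 by rewrite -(mulmxK Au a) a0 mul0mx.
  have {}b0 : b = 0 by rewrite -(mulmxK Cu b) b0 mul0mx.
  apply: vecP => [i|i|]; rewrite coord0.
  + by have /rowP/(_ i) := a0; rewrite !mxE.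
  + by have /rowP/(_ i) := b0; rewrite !mxE.
  have := congr1 (fun u : 'rV[R]_7 => u 0 ctr) e.
  rewrite /X' /W' !sum3 !coordE !(mulr0, add0r) mulr1 => /eqP.
  by rewrite !mulf_eq0 invr_eq0 (negPf dA) (negPf r0) !orbF => /eqP.
- move=> j; apply: vecP => [i|i|]; rewrite ?br_model_gen ?br_model_com ?br_model_ctr.
  + by rewrite /W' sum3 !coordE; ring.
  + rewrite /W' sum3 !coordE /C !mxE.
    by elim/ord3_ind: i; rewrite /=; ring.
  rewrite /pairing big1 => [|k _].
    by rewrite /W' sum3 !coordE; ring.
  by rewrite big1 // => l _; rewrite !X'c !(mulr0, mul0r) subr0 mulr0.
- by move=> i; rewrite brZr modelG scaler0.
- move=> i j; rewrite br_suml big1 // => k _; rewrite brZl br_sumr big1 ?scaler0 // => l _.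
  by rewrite brZr modelWW scaler0.
by move=> i; rewrite brZr modelG scaler0.
Qed.

Definition rows3 (u v w : 'rV[R]_3) : 'M[R]_3 :=
  \matrix_(i < 3) nth 0 [:: u; v; w] i.

Lemma mul_rows3 (u v w x : 'rV[R]_3) :
  x *m rows3 u v w = x 0 i0 *: u + x 0 i1 *: v + x 0 i2 *: w.
Proof. by rewrite mulmx_sum_row sum3 !rowK. Qed.

Lemma rows3P M u v w N :
  u *m M = N i0 i0 *: u + N i0 i1 *: v + N i0 i2 *: w ->
  v *m M = N i1 i0 *: u + N i1 i1 *: v + N i1 i2 *: w ->
  w *m M = N i2 i0 *: u + N i2 i1 *: v + N i2 i2 *: w ->
  rows3 u v w *m M = N *m rows3 u v w.
Proof.
move=> Hu Hv Hw; apply/row_matrixP => i; rewrite !row_mul mul_rows3 !mxE.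
by elim/ord3_ind: i; rewrite rowK.
Qed.

(** The linear coefficient p of the characteristic polynomial X^3 + p X - det M of a
traceless matrix; [disc] is minus its discriminant. *)
Definition char_lin M : R := - \tr (M *m M) / 2.
Definition disc M : R := 4 * char_lin M ^+ 3 + 27 * \det M ^+ 2.

Lemma char_traceless M l : \tr M = 0 ->
  \det (M - l%:M) = - (l ^+ 3 + char_lin M * l - \det M).
Proof.
rewrite /char_lin !trace3 !det3 !mxE /= !sum3 ?mulr1n ?mulr0n => trM.
have -> : M i2 i2 = - M i0 i0 - M i1 i1 by lra.
by field.
Qed.

Lemma Cayley_Hamilton_traceless M : \tr M = 0 ->
  M *m M *m M + char_lin M *: M - (\det M)%:M = 0.
Proof.
rewrite /char_lin !trace3 !det3 => trM.
have e22 : M i2 i2 = - M i0 i0 - M i1 i1 by lra.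
apply/matrixP; elim/ord3_ind; elim/ord3_ind; rewrite ?(mxE, sum3) /= ?mulr1n ?mulr0n e22; by field.
Qed.

Lemma eigenvector M l : \tr M = 0 -> l ^+ 3 + char_lin M * l - \det M = 0 ->
  exists2 v : 'rV_3, v != 0 & v *m M = l *: v.
Proof.
move=> trM e; have /eqP/det0P[v nz Hv] : \det (M - l%:M) = 0.
  by rewrite char_traceless // e oppr0.
exists v => //; apply/eqP; rewrite -subr_eq0; move: Hv.
by rewrite mulmxBr mul_mx_scalar => ->.
Qed.

(** Scaling the eigenvalue [e1] to -1 turns the others into t and 1 - t, since their
sum is zero. *)
Lemma isomorphic_split M e1 e2 e3 : \tr M = 0 ->
  e1 ^+ 3 + char_lin M * e1 - \det M = 0 -> e2 ^+ 3 + char_lin M * e2 - \det M = 0 ->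
  e3 ^+ 3 + char_lin M * e3 - \det M = 0 ->
  e1 != e2 -> e1 != e3 -> e2 != e3 -> e1 != 0 -> e1 + e2 + e3 = 0 ->
  isomorphic (model M) (model (mx147E (- e2 / e1))).
Proof.
move=> trM r1 r2 r3 n12 n13 n23 n1 s0.
have [u u0 uE] := eigenvector trM r1.
have [v v0 vE] := eigenvector trM r2.
have [w w0 wE] := eigenvector trM r3.
apply: (@isomorphic_similar _ _ (rows3 u v w) (- e1^-1)).
- apply: unitmx_kernel => x; rewrite mul_rows3 => H.
  have H1 := congr1 (mulmx^~ M) H; rewrite !mulmxDl -!scalemxAl uE vE wE mul0mx in H1.
  have H2 := congr1 (mulmx^~ M) H1; rewrite !mulmxDl -!scalemxAl uE vE wE mul0mx in H2.
  (* The relation multiplied by (M - a) (M - b) isolates one eigenvector. *)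
  have P a b : (x 0 i0 * ((e1 - a) * (e1 - b))) *: u +
     (x 0 i1 * ((e2 - a) * (e2 - b))) *: v + (x 0 i2 * ((e3 - a) * (e3 - b))) *: w = 0.
    have lin (L0 L1 L2 : R) : L0 = 0 -> L1 = 0 -> L2 = 0 ->
        L2 - (a + b) * L1 + a * b * L0 = 0 by move=> -> -> ->; ring.
    apply/rowP => k; move/rowP/(_ k): H; move/rowP/(_ k): H1; move/rowP/(_ k): H2.
    rewrite !mxE => h2 h1 h0; rewrite -[RHS](lin _ _ _ h0 h1 h2); ring.
  have K (y : 'rV[R]_3) (k a b : R) : y != 0 -> a != 0 -> b != 0 ->
     (k * (a * b)) *: y = 0 -> k = 0.
    move=> y0 a0 b0 /eqP; rewrite scaler_eq0 (negPf y0) orbF.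
    by rewrite !mulf_eq0 (negPf a0) (negPf b0) !orbF => /eqP.
  have Z i : x 0 i = 0.
    elim/ord3_ind: i.
    + apply: (K u _ (e1 - e2) (e1 - e3)); rewrite ?subr_eq0 //.
      by have := P e2 e3; rewrite !subrr !(mulr0, mul0r, scale0r, addr0).
    + apply: (K v _ (e2 - e1) (e2 - e3)); rewrite ?subr_eq0 // 1?eq_sym //.
      by have := P e1 e3; rewrite !subrr !(mulr0, mul0r, scale0r, addr0, add0r).
    apply: (K w _ (e3 - e1) (e3 - e2)); rewrite ?subr_eq0 // 1?eq_sym //.
    by have := P e1 e2; rewrite !subrr !(mulr0, mul0r, scale0r, addr0, add0r).
  by apply/rowP => i; rewrite Z mxE.
- by rewrite oppr_eq0 invr_eq0.
rewrite scalemxAr; apply: rows3P; rewrite -scalemxAr ?uE ?vE ?wE !mxE /= !scalerA !scale0r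
  ?add0r ?addr0; congr (_ *: _).
- by rewrite mulNr mulVf.
- by rewrite mulrC mulrN mulNr.
have -> : e3 = - e1 - e2 by lra.
by field.
Qed.

(** Write p = -3 s^2.  The cubic has its critical points at -s and s, and the sign
of [disc] says that its values there have opposite signs, so the points
-2s, -s, s, 2s separate three roots.  Two of them have the same sign; taking
t - 1 to be the ratio of these two gives t > 2 or 1 < t < 2 according to the
order. *)
Lemma isomorphic_147E M : \tr M = 0 -> \det M != 0 -> disc M < 0 ->
  (exists2 t, 1 < t < 2 & isomorphic (model M) (model (mx147E t))) /\
  (exists2 t, 2 < t & isomorphic (model M) (model (mx147E t))).
Proof.
move=> trM dM D; set p := char_lin M; set q := - \det M.
have q0 : q != 0 by rewrite oppr_eq0.
have pneg : p < 0.
  rewrite ltNge; apply/negP => p0; move: D; rewrite ltNge /disc -/p => /negP; apply.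
  apply: addr_ge0; apply: mulr_ge0; rewrite ?ler0n ?sqr_ge0 //; exact: exprn_ge0.
pose s := Num.sqrt (- p / 3).
have s2 : s ^+ 2 = - p / 3 by rewrite sqr_sqrtr // divr_ge0 // oppr_ge0 ltW.
have sp : 0 < s by rewrite sqrtr_gt0 divr_gt0 // oppr_gt0.
have pE : p = - 3 * s ^+ 2 by rewrite s2; field.
have s3 : 0 < s ^+ 3 by rewrite exprn_gt0.
have qs : q ^+ 2 < (2 * s ^+ 3) ^+ 2.
  by move: D; rewrite /disc -/p pE /q; move: (\det M) => d; lra.
have q1 : - (2 * s ^+ 3) < q by rewrite ltNge; apply/negP => h; nra.
have q2 : q < 2 * s ^+ 3 by rewrite ltNge; apply/negP => h; nra.
pose f : {poly R} := 'X^3 + p *: 'X + q%:P.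
have fE x : f.[x] = x ^+ 3 + p * x + q by rewrite !hornerE.
have fN x : (- f).[x] = - (x ^+ 3 + p * x + q) by rewrite hornerN fE.
have rt x : root f x -> x ^+ 3 + char_lin M * x - \det M = 0.
  by move/rootP; rewrite fE.
have [r1 /andP[r1a r1b] /rt r1E] : exists2 x, - (2 * s) <= x <= - s & root f x.
  by apply: poly_ivt; rewrite ?fE ?pE; first lra; apply/andP; split; lra.
have [r2 /andP[r2a r2b] r2f] : exists2 x, - s <= x <= s & root (- f) x.
  by apply: poly_ivt; rewrite ?fN ?pE; first lra; apply/andP; split; lra.
have r2E : r2 ^+ 3 + char_lin M * r2 - \det M = 0 by apply: rt; move: r2f; rewrite rootN.
have [r3 /andP[r3a r3b] /rt r3E] : exists2 x, s <= x <= 2 * s & root f x.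
  by apply: poly_ivt; rewrite ?fE ?pE; first lra; apply/andP; split; lra.
have r12 : r1 < r2.
  rewrite lt_neqAle (le_trans r1b r2a) andbT; apply/eqP => e.
  have r1s : r1 = - s by apply/le_anti; rewrite r1b e r2a.
  by move: r1E; rewrite r1s -/p pE -/q; lra.
have r23 : r2 < r3.
  rewrite lt_neqAle (le_trans r2b r3a) andbT; apply/eqP => e.
  have r1s : r3 = s by apply/le_anti; rewrite r3a -e r2b.
  by move: r3E; rewrite r1s -/p pE -/q; lra.
have sum0 : r1 + r2 + r3 = 0.
  have : (r1 - r2) * (r1 - r3) * (r2 - r3) * (r1 + r2 + r3) = 0.
    move: r1E r2E r3E; rewrite -/p -/q => r1E r2E r3E.
    have e1 : q = - (r1 ^+ 3 + p * r1) by lra.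
    rewrite e1 in r2E r3E.
    have e2 : p * (r2 - r1) = r1 ^+ 3 - r2 ^+ 3 by lra.
    have e3 : p * (r3 - r1) = r1 ^+ 3 - r3 ^+ 3 by lra.
    have : (r1 ^+ 3 - r2 ^+ 3) * (r3 - r1) = (r1 ^+ 3 - r3 ^+ 3) * (r2 - r1).
      by rewrite -e2 -e3; ring.
    lra.
  by move/eqP; rewrite !mulf_eq0 !subr_eq0 (lt_eqF r12) (lt_eqF r23)
    (lt_eqF (lt_trans r12 r23)) /= => /eqP.
have nz r : r ^+ 3 + char_lin M * r - \det M = 0 -> r != 0.
  move=> rE; apply/eqP => r0; move: rE; rewrite r0 -/p -/q.
  by rewrite expr0n mulr0 !add0r => /eqP; rewrite (negPf q0).
have n1 := nz _ r1E; have n2 := nz _ r2E; have n3 := nz _ r3E.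
have iso a b c (aE : a ^+ 3 + char_lin M * a - \det M = 0)
   (bE : b ^+ 3 + char_lin M * b - \det M = 0) (cE : c ^+ 3 + char_lin M * c - \det M = 0) :=
  isomorphic_split trM aE bE cE.
have n12 : r1 != r2 by rewrite lt_eqF.
have n23 : r2 != r3 by rewrite lt_eqF.
have n13 : r1 != r3 by rewrite lt_eqF // (lt_trans r12).
have n21 : r2 != r1 by rewrite eq_sym.
have n32 : r3 != r2 by rewrite eq_sym.
have n31 : r3 != r1 by rewrite eq_sym.
have r1n : r1 < 0 by move: sum0 r12 r23; clear; lra.
have r3p : 0 < r3 by move: sum0 r12 r23; clear; lra.
have s123 := sum0; have s132 : r1 + r3 + r2 = 0 by rewrite -sum0; ring.
have s213 : r2 + r1 + r3 = 0 by rewrite -sum0; ring.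
have s231 : r2 + r3 + r1 = 0 by rewrite -sum0; ring.
have s312 : r3 + r1 + r2 = 0 by rewrite -sum0; ring.
have div (a b k l : R) : 0 < a -> k * a < b -> b < l * a -> k < b / a < l.
  by move=> a0 h1 h2; rewrite ltr_pdivlMr // ltr_pdivrMr // h1 h2.
have divN (a b : R) : - b / a = b / (- a) by rewrite invrN mulrN mulNr.
have [r2p|r2n|r20] := ltrgt0P r2; last by rewrite r20 eqxx in n2.
- split.
    exists (- r1 / r3); last exact: (iso r3 r1 r2).
    by apply: div => //; move: sum0 r2p r23; clear; lra.
  exists (- r1 / r2); last exact: (iso r2 r1 r3).
  by rewrite ltr_pdivlMr //; move: sum0 r2p r23; clear; lra.
split.
  exists (- r3 / r1); last exact: (iso r1 r3 r2).
  by rewrite divN; apply: div; rewrite ?oppr_gt0 //; move: sum0 r2n r12; clear; lra.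
exists (- r3 / r2); last exact: (iso r2 r3 r1).
by rewrite divN ltr_pdivlMr ?oppr_gt0 //; move: sum0 r2n r12; clear; lra.
Qed.

End Similarity.

Section Complex.
Variable R : realType.
Implicit Types (N M A K : 'M[R]_3) (t r : R).
(** For a real root [l], [disc] factors as (4 p + 3 l^2) (p + 3 l^2)^2, so its sign
says that the other two roots are not real.  After scaling [l] to -2, by
Cayley-Hamilton a nonzero row of M + 2 is killed by M^2 - 2 M + t^2; together with
its image and the real eigenvector it brings the scaled M to the required form. *)
Lemma isomorphic_147E1 M : \tr M = 0 -> \det M != 0 -> 0 < disc M ->
  exists2 t, 1 < t & isomorphic (model M) (model (mx147E1 t)).
Proof.
move=> trM dM D; set p := char_lin M; set q := - \det M.
pose f : {poly R} := 'X^3 + p *: 'X + q%:P.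
have fE x : f.[x] = x ^+ 3 + p * x + q by rewrite !hornerE.
have [B B1 pqB] : exists2 B, 1 <= B & `|p| + `|q| <= B.
  exists (1 + `|p| + `|q|); have := normr_ge0 p; have := normr_ge0 q;
  by move: `|p| `|q|; clear => u v; lra.
have [l _ /rootP] : exists2 x, - B <= x <= B & root f x.
  have p0 := normr_ge0 p; have q0 := normr_ge0 q.
  have B0 : 0 <= B by lra.
  have /andP[p1 p2] : - `|p| <= p <= `|p| by rewrite -ler_norml.
  have /andP[q1 q2] : - `|q| <= q <= `|q| by rewrite -ler_norml.
  have big : `|p| * B + `|q| <= B ^+ 3.
    have : `|q| <= `|q| * B by rewrite ler_peMr.
    have : (`|p| + `|q|) * B <= B * B by rewrite ler_wpM2r.
    have : B * B <= B * B * B by rewrite ler_peMr // mulr_ge0.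
    by move: `|p| `|q|; clear => u v; lra.
  have pB1 : - (`|p| * B) <= p * B by rewrite -mulNr ler_wpM2r.
  have pB2 : p * B <= `|p| * B by rewrite ler_wpM2r.
  apply: poly_ivt; rewrite ?fE ?mulrN; first by lra.
  move: big pB1 pB2 q1 q2; move: (p * B) (`|p| * B) `|q| => u v w; clear.
  by move=> *; apply/andP; split; lra.
rewrite fE => lE.
have qE : q = - (l ^+ 3 + p * l) by lra.
have l0 : l != 0.
  apply/eqP => l0; move: dM; rewrite -oppr_eq0 -/q qE l0.
  by rewrite expr0n mulr0 addr0 oppr0 eqxx.
have DE : disc M = (4 * p + 3 * l ^+ 2) * (p + 3 * l ^+ 2) ^+ 2.
  by rewrite /disc -/p -[\det M]opprK -/q qE; ring.
have h1 : 0 < 4 * p + 3 * l ^+ 2.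
  rewrite ltNge; apply/negP => h; move: D; rewrite DE ltNge => /negP; apply.
  by rewrite mulr_le0_ge0 // sqr_ge0.
have l2 : 0 < l ^+ 2 by rewrite exprn_even_gt0.
pose T := 4 * (p + l ^+ 2) / l ^+ 2.
have T1 : 1 < T by rewrite ltr_pdivlMr //; lra.
pose t := Num.sqrt T.
have t2 : t ^+ 2 = T by rewrite sqr_sqrtr // ltW // (lt_trans ltr01).
have t1 : 1 < t by rewrite -sqrtr1 ltr_sqrt // (lt_trans ltr01).
exists t => //.
pose M1 := (- 2 / l) *: M.
pose r := - 2 / l.
have CH : M1 *m M1 *m M1 + (T - 4) *: M1 + (2 * T)%:M = 0.
  have H := Cayley_Hamilton_traceless trM.
  have -> : M1 *m M1 *m M1 = r ^+ 3 *: (M *m M *m M).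
    by rewrite /M1 -!(scalemxAl, scalemxAr) !scalerA; congr (_ *: _); rewrite /r; ring.
  have -> : M *m M *m M = (\det M)%:M - p *: M.
    by apply/eqP; rewrite -subr_eq0 opprB addrA; apply/eqP; exact: H.
  rewrite -[\det M]opprK -/q qE /M1 scalerBr !scalerA opprK.
  by apply/matrixP => i j; rewrite !mxE /T /r; case: (i == j); rewrite ?mulr1n ?mulr0n; field.
have trM1 : \tr M1 = 0 by rewrite mxtraceZ trM mulr0.
have [i] : exists i, row i (M1 + 2%:M) != 0.
  apply/existsP; rewrite -negb_forall; apply/negP => /forallP M0.
  have : \tr (M1 + 2%:M) = 0.
    rewrite (_ : M1 + 2%:M = 0) ?mxtrace0 //; apply/row_matrixP => i.
    by rewrite (eqP (M0 i)) row0.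
  rewrite mxtraceD trM1 mxtrace_scalar add0r -mulrnA => /eqP.
  by rewrite pnatr_eq0.
set a := row i _ => a0.
have aK : a *m M1 *m M1 = 2 *: (a *m M1) - T *: a.
  have K : (M1 + 2%:M) *m M1 *m M1 = 2 *: ((M1 + 2%:M) *m M1) - T *: (M1 + 2%:M).
    apply/eqP; rewrite -subr_eq0; apply/eqP; rewrite -[RHS]CH.
    rewrite !mulmxDl !mul_scalar_mx -!scalemxAl.
    move: (M1 *m M1 *m M1) (M1 *m M1) => M3 M2.
    by apply/matrixP => j k; rewrite !mxE; case: (j == k); rewrite ?mulr1n ?mulr0n; ring.
  by rewrite /a -!row_mul K; apply/rowP => k; rewrite !mxE.
have [c c0 cE] : exists2 v : 'rV_3, v != 0 & v *m M1 = (- 2) *: v.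
  have [v v0 vE] := eigenvector trM lE; exists v => //.
  by rewrite /M1 -scalemxAr vE scalerA mulfVK.
have t0 : t != 0 by rewrite gt_eqF // (lt_trans ltr01).
have [b aE bE] : exists2 b, a *m M1 = - t *: b & b *m M1 = t *: a + 2 *: b.
  exists (- t^-1 *: (a *m M1)); first by rewrite scalerA mulrNN mulfV // scale1r.
  rewrite -scalemxAl aK -t2 scalerBr !scalerA addrC; congr (_ + _).
    by rewrite -scaleNr; congr (_ *: _); field.
  by congr (_ *: _); ring.
apply: (@isomorphic_similar _ _ _ (rows3 a b c) r).
- apply: unitmx_kernel => x; rewrite mul_rows3 => H.
  have H1 := congr1 (mulmx^~ M1) H; rewrite !mulmxDl -!scalemxAl aE bE cE mul0mx in H1.
  have H2 := congr1 (mulmx^~ M1) H1.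
  rewrite !mulmxDl -!scalemxAl !mulmxDl -!scalemxAl aE bE cE mul0mx in H2.
  have x2 : x 0 i2 = 0.
    have /eqP : (x 0 i2 * (8 + T)) *: c = 0.
      apply/rowP => k; move/rowP/(_ k): H; move/rowP/(_ k): H1; move/rowP/(_ k): H2.
      have lin (L0 L1 L2 : R) : L0 = 0 -> L1 = 0 -> L2 = 0 -> L2 - 2 * L1 + T * L0 = 0.
        by move=> -> -> ->; ring.
      rewrite !mxE -t2 => g2 g1 g0; rewrite -[RHS](lin _ _ _ g0 g1 g2) -t2; ring.
    rewrite scaler_eq0 (negPf c0) orbF mulf_eq0 [X in _ || X]gt_eqF ?orbF; first by move/eqP.
    by lra.
  rewrite x2 scale0r addr0 in H; rewrite x2 scale0r addr0 in H1.
  have /eqP : (2 * x 0 i0 * x 0 i1 - t * (x 0 i0 ^+ 2 + x 0 i1 ^+ 2)) *: a = 0.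
    apply/rowP => k; move/rowP/(_ k): H; move/rowP/(_ k): H1.
    have lin (L0 L1 : R) : L0 = 0 -> L1 = 0 ->
        (2 * x 0 i1 - t * x 0 i0) * L0 - x 0 i1 * L1 = 0 by move=> -> ->; ring.
    rewrite !mxE => g1 g0; rewrite -[RHS](lin _ _ g0 g1); ring.
  rewrite scaler_eq0 (negPf a0) orbF => /eqP Q0.
  (* The form 2 u v - t (u^2 + v^2) is negative definite because t > 1. *)
  have Z : x 0 i0 = 0 /\ x 0 i1 = 0.
    move: t1 Q0; move: (x 0 i0) (x 0 i1) => u v; clear=> t1 Q0.
    have h : u ^+ 2 + v ^+ 2 <= 0.
      by rewrite leNgt; apply/negP => h; have := sqr_ge0 (u - v); nra.
    have := sqr_ge0 u; have := sqr_ge0 v => hv hu.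
    by split; apply/eqP; rewrite -sqrf_eq0; apply/eqP; lra.
  by apply/rowP; case: Z => Z0 Z1; elim/ord3_ind; rewrite mxE.
- by rewrite mulf_neq0 ?invr_eq0 // oppr_eq0 pnatr_eq0.
rewrite scalemxAr -/M1; apply: rows3P; rewrite ?aE ?bE ?cE !mxE /= !scale0r ?add0r ?addr0 //.
Qed.
End Complex.

(** * Openness of the conditions, and the theorem *)
Section Rigidity.
Variable R : realType.
Implicit Types (N M A K : 'M[R]_3) (t r : R).
Local Notation X := (@genv R).
Local Notation W := (@comv R).
Local Notation G := (@ctrv R).

Section Continuity.
Variables (T : topologicalType) (a : T).

Lemma continuous_sumR (I : finType) (F : I -> T -> R) :
  (forall i, continuous_at a (F i)) ->
  continuous_at a (fun s => \sum_i F i s).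
Proof.
move=> H; elim: (index_enum I) => [|i r IH].
  by under eq_fun do rewrite big_nil; exact: cvg_cst.
by under eq_fun do rewrite big_cons; exact: cvgD (H i) IH.
Qed.

Lemma continuous_prodR (I : finType) (F : I -> T -> R) :
  (forall i, continuous_at a (F i)) ->
  continuous_at a (fun s => \prod_i F i s).
Proof.
move=> H; elim: (index_enum I) => [|i r IH].
  by under eq_fun do rewrite big_nil; exact: cvg_cst.
by under eq_fun do rewrite big_cons; exact: cvgM (H i) IH.
Qed.

Lemma continuous_det n (F : T -> 'M[R]_n) :
  (forall i j, continuous_at a (fun s => F s i j)) ->
  continuous_at a (fun s => \det (F s)).
Proof.
move=> H; apply: continuous_sumR => s; apply: cvgM; first exact: cst_continuous.
by apply: continuous_prodR => i; apply: H.
Qed.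

Lemma continuous_disc (F : T -> 'M[R]_3) :
  (forall i j, continuous_at a (fun s => F s i j)) ->
  continuous_at a (fun s => disc (F s)).
Proof.
move=> H; have D := continuous_det H.
have C : continuous_at a (fun s => char_lin (F s)).
  apply: cvgM; last exact: cvg_cst.
  apply: cvgN; apply: continuous_sumR => i.
  under eq_fun do rewrite mxE; apply: continuous_sumR => j.
  exact: cvgM (H i j) (H j i).
rewrite /disc; under eq_fun do rewrite !exprS !expr0 !mulr1.
apply: cvgD; apply: cvgM; try exact: cvg_cst; last exact: (cvgM D D).
exact: (cvgM C (cvgM C C)).
Qed.

End Continuity.

Lemma continuous_br (a : bilin R 7) (x y : bilin R 7 -> 'rV[R]_7) k :
  (forall i, continuous_at a (fun s => x s 0 i)) ->
  (forall i, continuous_at a (fun s => y s 0 i)) ->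
  continuous_at a (fun s => br s (x s) (y s) 0 k).
Proof.
move=> cx cy; under eq_fun do rewrite br_coord.
apply: continuous_sumR => i; apply: continuous_sumR => j.
exact: cvgM (cvgM (cx i) (cy j)) (@coord_continuous _ _ _ _ _ a).
Qed.

Lemma continuous_gen_br (a : bilin R 7) j k : continuous_at a (fun s => gen_br s j 0 k).
Proof.
apply: (@continuous_br a (fun=> X (nxt j)) (fun=> X (nxt (nxt j)))) => i; exact: cst_continuous.
Qed.

Lemma continuous_top_br (a : bilin R 7) p q k : continuous_at a (fun s => top_br s p q 0 k).
Proof.
apply: (@continuous_br a (fun=> X p) (gen_br (R := R) ^~ q)) => i; first exact: cst_continuous.
exact: continuous_gen_br.
Qed.

Lemma continuous_struct_mx (a : bilin R 7) i j : continuous_at a (fun s => struct_mx s i j).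
Proof.
under eq_fun do rewrite mxE.
apply: (@continuous_br a (fun=> X i) (gen_br (R := R) ^~ j)) => k; first exact: cst_continuous.
exact: continuous_gen_br.
Qed.

Lemma continuous_frame_mx (a : bilin R 7) p q :
  continuous_at a (fun s => \det (frame_mx X (gen_br s) (top_br s p q))).
Proof.
apply: continuous_det => i j; under eq_fun do rewrite mxE.
move: i; apply: ord7_ind => [i|i|].
- elim/ord3_ind: i; exact: cst_continuous.
- by elim/ord3_ind: i; exact: continuous_gen_br.
exact: continuous_top_br.
Qed.

(** At a model the basis and the matrix of the normal form are those of the model up
to the scale [N p q] of the last vector, so the two determinants are nonzero
there, hence nearby. *)
Lemma near_normal_form N p q : \det N != 0 -> N p q != 0 ->
  \forall nu \near model N, nilvar R 7 3 nu ->
    [/\ \tr (struct_mx nu) = 0, \det (struct_mx nu) != 0 & isomorphic nu (model (struct_mx nu))].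
Proof.
move=> dN Npq.
have gen_brE j : gen_br (model N) j = W j by exact: modelXX.
have struct_mxE : struct_mx (model N) = N.
  by apply/matrixP => i j; rewrite mxE gen_brE modelXW !coordE mulr1.
have top_brE : top_br (model N) p q = N p q *: G by rewrite /top_br gen_brE modelXW.
have Q0 : \det (frame_mx X (gen_br (model N)) (top_br (model N) p q)) != 0.
  rewrite -unitfE -unitmxE; apply: unitmx_kernel => v; rewrite mul_frame_mx top_brE.
  move=> e; apply: vecP => [i|i|]; rewrite coord0.
  - have := congr1 (fun u : 'rV[R]_7 => u 0 (gen i)) e.
    by rewrite !sum3 !gen_brE !coordE; elim/ord3_ind: i; rewrite /=; lra.
  - have := congr1 (fun u : 'rV[R]_7 => u 0 (com i)) e.
    by rewrite !sum3 !gen_brE !coordE; elim/ord3_ind: i; rewrite /=; lra.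
  have := congr1 (fun u : 'rV[R]_7 => u 0 ctr) e.
  rewrite !sum3 !gen_brE !coordE !(mulr0, add0r, mulr1) => /eqP.
  by rewrite mulf_eq0 (negPf Npq) orbF => /eqP.
have C1 := @continuous_frame_mx (model N) p q.
have C2 := continuous_det (@continuous_struct_mx (model N)).
have N1 := cvgr_neq0 _ C1 Q0.
have N2 : \forall nu \near model N, \det (struct_mx nu) != 0.
  by apply: (cvgr_neq0 _ C2); rewrite struct_mxE.
near=> nu => Vnu.
have dM : \det (struct_mx nu) != 0 by near: nu.
have Qu : frame_mx X (gen_br nu) (top_br nu p q) \in unitmx.
  by rewrite unitmxE unitfE; near: nu; exact: N1.
by have [trM iso] := nilvar_normal_form Vnu Qu dM; split.
Unshelve. all: by end_near.
Qed.

Lemma struct_mx_model N : struct_mx (model N) = N.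
Proof.
apply/matrixP => i j; rewrite mxE.
by rewrite -[gen_br _ _]/(br _ _ _) modelXX modelXW !coordE mulr1.
Qed.

Lemma near_disc_lt0 N : disc N < 0 -> \forall nu \near model N, disc (struct_mx nu) < 0.
Proof.
move=> D; have C := continuous_disc (@continuous_struct_mx (model N)).
by apply: (cvgr_lt _ C); rewrite struct_mx_model.
Qed.

Lemma near_disc_gt0 N : 0 < disc N -> \forall nu \near model N, 0 < disc (struct_mx nu).
Proof.
move=> D; have C := continuous_disc (@continuous_struct_mx (model N)).
by apply: (cvgr_gt _ C); rewrite struct_mx_model.
Qed.

Lemma disc_mx147E t : disc (mx147E t) = - ((t + 1) * (2 * t - 1) * (t - 2)) ^+ 2.
Proof. by rewrite /disc /char_lin det_mx147E trace3 !mxE !sum3 !mxE /=; field. Qed.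

Lemma disc_mx147E1 t : disc (mx147E1 t) = 4 * (t ^+ 2 - 1) * (t ^+ 2 + 8) ^+ 2.
Proof. by rewrite /disc /char_lin det_mx147E1 trace3 !mxE !sum3 !mxE /=; field. Qed.

(** Stated for any set of parameters reaching every matrix with three distinct real
nonzero eigenvalues, to serve both intervals. *)
Lemma rigid_147E (T : set R) : open T -> (forall t, T t -> 1 < t /\ t != 2) ->
  (forall M, \tr M = 0 -> \det M != 0 -> disc M < 0 ->
     exists2 t, T t & isomorphic (model M) (model (mx147E t))) ->
  rigid_curve (nilvar R 7 3) T (@g147E R).
Proof.
move=> oT T12 HT; split=> //.
- by move=> t _; have [] := affine_derive1 t (g147E_affine R).
- by move=> t _; rewrite g147E_model; exact/model_nilvar/tr_mx147E.
move=> t /T12[t1 t2]; rewrite g147E_model.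
have dN : \det (mx147E t) != 0 by rewrite det_mx147E mulf_neq0 ?subr_eq0; lra.
have Npq : mx147E t i0 i0 != 0 by rewrite !mxE /= oppr_eq0 oner_eq0.
have D : disc (mx147E t) < 0.
  rewrite disc_mx147E oppr_lt0 exprn_even_gt0 //= !mulf_neq0 ?subr_eq0 //; lra.
have A1 := near_normal_form dN Npq; have A2 := near_disc_lt0 D.
rewrite near_withinE; near=> nu => Vnu.
have [//|trM dM iso] : nilvar R 7 3 nu -> [/\ \tr (struct_mx nu) = 0, \det (struct_mx nu) != 0
   & isomorphic nu (model (struct_mx nu))] by near: nu.
have [|u Tu isou] := HT _ trM dM; first by near: nu.
by exists u => //; rewrite g147E_model; apply: isomorphic_trans isou.
Unshelve. all: by end_near.
Qed.

Lemma rigid_147E1 : rigid_curve (nilvar R 7 3) `]1, +oo[ (@g147E1 R).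
Proof.
split.
- exact: interval_open.
- by move=> t _; have [] := affine_derive1 t (g147E1_affine R).
- by move=> t _; rewrite g147E1_model; exact/model_nilvar/tr_mx147E1.
move=> t /=; rewrite in_itv /= andbT => t1; rewrite g147E1_model.
have t0 : t != 0 by lra.
have dN : \det (mx147E1 t) != 0.
  by rewrite det_mx147E1 mulf_neq0 ?expf_neq0 // oppr_eq0 pnatr_eq0.
have Npq : mx147E1 t i2 i2 != 0 by rewrite !mxE /= oppr_eq0 pnatr_eq0.
have D : 0 < disc (mx147E1 t).
  rewrite disc_mx147E1 mulr_gt0 ?exprn_even_gt0 //=; nra.
have A1 := near_normal_form dN Npq; have A2 := near_disc_gt0 D.
rewrite near_withinE; near=> nu => Vnu.
have [//|trM dM iso] : nilvar R 7 3 nu -> [/\ \tr (struct_mx nu) = 0, \det (struct_mx nu) != 0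
   & isomorphic nu (model (struct_mx nu))] by near: nu.
have [|u Tu isou] := isomorphic_147E1 trM dM; first by near: nu.
exists u; first by rewrite /= in_itv /= Tu.
by rewrite g147E1_model; apply: isomorphic_trans isou.
Unshelve. all: by end_near.
Qed.

End Rigidity.

Theorem mainTheorem9 (R : realType) :
  [/\ (forall t : R, 1 < t ->
         [/\ dim_H2nil 3 (g147E1 t) 1,
             Z2nil 3 (g147E1 t) (derive1 (@g147E1 R) t)
           & ~ B2 (g147E1 t) (derive1 (@g147E1 R) t)]),
      (forall t : R, 1 < t -> t != 2 ->
         [/\ dim_H2nil 3 (g147E t) 1,
             Z2nil 3 (g147E t) (derive1 (@g147E R) t)
           & ~ B2 (g147E t) (derive1 (@g147E R) t)]),
      dim_H2nil 3 (g147E (2 : R)) 3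
    & [/\ rigid_curve (nilvar R 7 3) `]1, 2[ (@g147E R),
          rigid_curve (nilvar R 7 3) `]2, +oo[ (@g147E R)
        & rigid_curve (nilvar R 7 3) `]1, +oo[ (@g147E1 R)]].

Proof.
split.
- move=> t t1; have t0 : t != 0 by lra.
  by have [] := tangent_147E1 t0; split=> //; exact: dim_H2_147E1.
- by move=> t t1 t2; have [] := tangent_147E t; split=> //; exact: dim_H2_147E.
- exact: dim_H2_147E_2.
split.
- apply: rigid_147E => [|t|M tM dM DM]; first exact: interval_open.
    by rewrite /= in_itv /= => /andP[t1 t2]; split=> //; rewrite lt_eqF.
  have [[t t12 iso] _] := isomorphic_147E tM dM DM.
  by exists t => //=; rewrite in_itv.
- apply: rigid_147E => [|t|M tM dM DM]; first exact: interval_open.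
    rewrite /= in_itv /= andbT => t2; split; last by rewrite gt_eqF.
    by apply: lt_trans t2; rewrite ltrDl.
  have [_ [t t2 iso]] := isomorphic_147E tM dM DM.
  by exists t => //=; rewrite in_itv /= t2.
exact: rigid_147E1.
Qed.
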